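(* Let $g\in H(\mathbb{D})$, let $\nu$ be a weight satisfying property (U) and let $\mu$ be a weight. Then the following are equivalent: (1) $S_g: H^{\infty}_\nu\rightarrow \mathcal{B}^{\infty}_\mu$ is bounded; (2) $\sup_{z\in\mathbb{D}}\frac{\mu(z)}{(1-|z|^2)\nu(z)}|g(z)|<\infty$. If, in addition, $\nu$ and $\mu$ are typical weights, then (1) and (2) are also equivalent to (3) $S_g: H^{0}_\nu\rightarrow \mathcal{B}^{0}_\mu$ is bounded.
   Context: $\mathbb{D}$ is the open unit disk and $H(\mathbb{D})$ the space of analytic functions on $\mathbb{D}$. A weight is a non-negative continuous function $\nu$ on $\mathbb{D}$ with $\nu(z)=\nu(|z|)$ for all $z$, which is decreasing in $|z|$. For a weight $\nu$: $H^{\infty}_\nu=\{f\in H(\mathbb{D}): \sup_{z}\nu(z)|f(z)|<\infty\}$, $H^{0}_\nu=\{f\in H(\mathbb{D}): \lim_{|z|\to1^-}\nu(z)|f(z)|=0\}$, $\mathcal{B}^{\infty}_\nu=\{f\in H(\mathbb{D}): |f(0)|+\sup_{z}\nu(z)|f'(z)|<\infty\}$, $\mathcal{B}^{0}_\nu=\{f\in H(\mathbb{D}): \lim_{|z|\to1^-}\nu(z)|f'(z)|=0\}$, each with its natural norm. A weight $\nu$ is typical if $\lim_{|z|\to1^-}\nu(z)=0$. A weight $\nu$ satisfies property (U) if there is $\alpha>0$ such that $r\mapsto \nu(r)/(1-r^2)^\alpha$ is almost increasing on $[0,1)$ (i.e. there is $C>0$ with $h(r)\le C h(s)$ whenever $r\le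 s$), equivalently $\inf_n \nu(1-2^{-(n+1)})/\nu(1-2^{-n})>0$. For $g\in H(\mathbb{D})$, $(S_gf)(z)=\int_0^z f'(\omega)g(\omega)\,d\omega$. *)

(* Defs.v *)
From Stdlib Require Import Reals ClassicalEpsilon.
From Coquelicot Require Import Coquelicot.
Open Scope R_scope.

Definition inD (z : C) : Prop := Cmod z < 1.

Definition analytic (f : C -> C) : Prop :=
  forall z : C, inD z -> ex_derive (K := C_AbsRing) (V := C_NormedModule) f z.

(* the complex derivative f'(z) (chosen value of the derivative, meaningful on D) *)
Definition cderiv (f : C -> C) (z : C) : C :=
  epsilon (inhabits (0 : C))
    (fun l : C => is_derive (K := C_AbsRing) (V := C_NormedModule) f z l).

(* (S_g f)(z) = int_0^z f'(w) g(w) dw, along the segment [0,z]: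
   = int_0^1 f'(t z) g(t z) z dt *)
Definition Sg (g f : C -> C) (z : C) : C :=
  @RInt C_R_CompleteNormedModule
    (fun t : R => Cmult (Cmult (cderiv f (Cmult (RtoC t) z)) (g (Cmult (RtoC t) z))) z) 0 1.

(* A weight: nu is given as its radial profile nu : [0,1) -> R, nu(z) := nu(|z|);
   non-negative, continuous and (non-strictly) decreasing on [0,1). *)
Definition weight (nu : R -> R) : Prop :=
  (forall r, 0 <= r < 1 -> 0 <= nu r) /\
  (forall r, 0 <= r < 1 -> continuity_pt nu r) /\
  (forall r s, 0 <= r -> r <= s -> s < 1 -> nu s <= nu r).

Definition typical (nu : R -> R) : Prop :=
  forall eps, 0 < eps -> exists r0, r0 < 1 /\
    forall r, r0 < r < 1 -> 0 <= r -> Rabs (nu r) < eps.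

Definition almost_increasing (h : R -> R) : Prop :=
  exists C, 0 < C /\ forall r s, 0 <= r -> r <= s -> s < 1 -> h r <= C * h s.

Definition property_U (nu : R -> R) : Prop :=
  exists alpha, 0 < alpha /\
    almost_increasing (fun r => nu r / Rpower (1 - r ^ 2) alpha).

Definition Hnorm_le (nu : R -> R) (f : C -> C) (K : R) : Prop :=
  forall z, inD z -> nu (Cmod z) * Cmod (f z) <= K.

Definition in_Hinf (nu : R -> R) (f : C -> C) : Prop :=
  analytic f /\ exists K, Hnorm_le nu f K.

Definition in_H0 (nu : R -> R) (f : C -> C) : Prop :=
  analytic f /\
  forall eps, 0 < eps -> exists r0, r0 < 1 /\
    forall z, inD z -> r0 < Cmod z -> nu (Cmod z) * Cmod (f z) < eps.

Definition Bnorm_le (mu : R -> R) (h : C -> C) (K : R) : Prop :=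
  forall z, inD z -> Cmod (h 0) + mu (Cmod z) * Cmod (cderiv h z) <= K.

Definition in_Binf (mu : R -> R) (h : C -> C) : Prop :=
  analytic h /\ exists K, Bnorm_le mu h K.

Definition in_B0 (mu : R -> R) (h : C -> C) : Prop :=
  analytic h /\
  forall eps, 0 < eps -> exists r0, r0 < 1 /\
    forall z, inD z -> r0 < Cmod z -> mu (Cmod z) * Cmod (cderiv h z) < eps.

Definition Sg_bounded_inf (g : C -> C) (nu mu : R -> R) : Prop :=
  exists M, 0 <= M /\ forall f, in_Hinf nu f ->
    in_Binf mu (Sg g f) /\
    forall K, Hnorm_le nu f K -> Bnorm_le mu (Sg g f) (M * K).

Definition Sg_bounded_0 (g : C -> C) (nu mu : R -> R) : Prop :=
  exists M, 0 <= M /\ forall f, in_H0 nu f ->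
    in_B0 mu (Sg g f) /\
    forall K, Hnorm_le nu f K -> Bnorm_le mu (Sg g f) (M * K).

(* condition (2): sup_z mu(z)|g(z)| / ((1-|z|^2) nu(z)) < infinity,
   written without division *)
Definition cond2 (g : C -> C) (nu mu : R -> R) : Prop :=
  exists M, forall z, inD z ->
    mu (Cmod z) * Cmod (g z) <= M * ((1 - Cmod z ^ 2) * nu (Cmod z)).

(* Main.v *)
(* The upper bound is Cauchy's estimate on the circle of radius (1-|z|)/2: by
   property (U) nu is comparable at z and on that circle, so
   (1-|z|^2) nu(z) |f'(z)| <= K sup nu|f|, the supremum being over the circle only,
   which gives the bounded and the vanishing case at once; then (S_g f)' = f' g.
   For the converse one tests with f_a(z) = (z-a) / (1 - conj(a) z)^(n+1), n >= alpha:
   the Schwarz-Pick factor |z-a| <= |1 - conj(a) z| and property (U) give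
   nu|f_a| <= K nu(a) / (1-|a|^2)^n, whereas f_a'(a) = 1 / (1-|a|^2)^(n+1).

   Cauchy's theorem comes from Goursat's quadrisection, applied not to a domain in C
   but to a parameter rectangle of a map P(s,t): the integral of f(P) dP over its
   boundary vanishes. The maps t(z+sk), c(t)-z0-s(z-z0) and z+s(c(t)-z), with c a
   circle around z0, give the primitive of f on the disk, the winding number of c and
   the Cauchy formula. *)
Require Import Defs.
From Stdlib Require Import Reals Lra Lia ClassicalEpsilon.
From Coquelicot Require Import Coquelicot.
Open Scope R_scope.

(** The obstacle is that [analytic] only asks for a complex derivative at each point of the disk,
    with no continuity of that derivative. Yet [Sg] integrates f' g, so even its being a primitive
    requires f' to be analytic, hence the Cauchy formula, hence Cauchy's theorem under pointwise
    differentiability alone.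

    A parameter rectangle replaces the geometry of curves: a side may collapse to a point, and two
    opposite sides that trace the same path cancel. So deforming a closed curve is one application
    of the same lemma, without homotopies or domains.

    The circle of radius (1-|z|)/2 stays in |w| <= (1+|z|)/2, which halves the distance to the
    boundary; property (U) pays a constant factor for exactly such a step.

    All weight inequalities are kept free of division, because [weight] allows nu to vanish; a
    quotient by nu is formed only after the zero case has been split off. *)

Notation ex_Cder f z :=
  (ex_derive (K := C_AbsRing) (V := C_NormedModule) f z).

(** * Complex and real derivatives of complex-valued functions *)

Notation Cder f z l :=
  (is_derive (K := C_AbsRing) (V := C_NormedModule) f z l).
Notation Rder u t l :=
  (is_derive (K := R_AbsRing) (V := C_R_NormedModule) u t l).
Notation Rcont u t := (continuous (T := R_UniformSpace) (U := C_UniformSpace) u t).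

Definition CInt (u : R -> C) (a b : R) : C :=
  @RInt C_R_CompleteNormedModule u a b.

Lemma Cplus_cancel_l (a b c : C) : (a + b = a + c)%C -> b = c.
Proof. intros H. replace b with ((a + b) - a)%C by ring. rewrite H. ring. Qed.

Lemma Cminus_eq_0 (a b : C) : (a - b)%C = 0%C -> a = b.
Proof. intros H. replace a with ((a - b) + b)%C by ring. rewrite H. ring. Qed.

Lemma Cmod_triangle_sub (x y : C) : Cmod (x - y) <= Cmod x + Cmod y.
Proof.
  unfold Cminus. rewrite <- (Cmod_opp y). apply Cmod_triangle.
Qed.

Lemma Cmod_triangle_inv (x y : C) : Cmod x - Cmod y <= Cmod (x - y).
Proof.
  generalize (Cmod_triangle (x - y) y).
  replace (x - y + y)%C with x by ring. lra.
Qed.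

Lemma locally_Cmod (z : C) (P : C -> Prop) :
  locally (T := AbsRing_UniformSpace C_AbsRing) z P <->
  exists d, 0 < d /\ forall w, Cmod (w - z) < d -> P w.
Proof.
  split.
  - intros [d H]. exists d. split; [apply cond_pos|].
    intros w Hw. apply H. exact Hw.
  - intros [d [Hd H]]. exists (mkposreal d Hd). intros w Hw. apply H. exact Hw.
Qed.

(** Trades the filter definition for a remainder bound in [Cmod], the form in which difference
    quotients and integral remainders are estimated below. *)
Lemma Cder_eps (f : C -> C) (z l : C) :
  Cder f z l <->
  forall e, 0 < e -> exists d, 0 < d /\ forall w, Cmod (w - z) < d ->
    Cmod (f w - f z - (w - z) * l) <= e * Cmod (w - z).
Proof.
  split.
  - intros [_ H] e He.
    assert (Hz : is_filter_lim (locally (T := AbsRing_UniformSpace C_AbsRing) z) z).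
    { intros P HP. exact HP. }
    specialize (H z Hz (mkposreal e He)).
    apply locally_Cmod in H. destruct H as [d [Hd H]].
    exists d. split; [exact Hd|]. intros w Hw. specialize (H w Hw). exact H.
  - intros H. split.
    + apply is_linear_scal_l.
    + intros x Hx [e He].
      assert (E : z = x).
      { apply (is_filter_lim_locally_unique (K := C_AbsRing)
                 (V := AbsRing_NormedModule C_AbsRing)). exact Hx. }
      subst x. apply locally_Cmod. destruct (H e He) as [d [Hd H']].
      exists d. split; [exact Hd|]. intros w Hw. exact (H' w Hw).
Qed.

Lemma Cder_unique (f : C -> C) (z l m : C) : Cder f z l -> Cder f z m -> l = m.
Proof.
  intros Hl Hm. rewrite <- (is_C_derive_unique f z l Hl).
  apply is_C_derive_unique. exact Hm.
Qed.

Lemma Cder_ext (f g : C -> C) (z l : C) (d : R) : 0 < d ->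
  (forall w, Cmod (w - z) < d -> f w = g w) -> Cder f z l -> Cder g z l.
Proof.
  intros Hd H. apply is_derive_ext_loc. apply locally_Cmod.
  exists d. split; assumption.
Qed.

Lemma cderiv_correct (f : C -> C) (z : C) :
  ex_Cder f z -> Cder f z (cderiv f z).
Proof. intros H. unfold cderiv. apply epsilon_spec. exact H. Qed.

Lemma cderiv_unique (f : C -> C) (z l : C) : Cder f z l -> cderiv f z = l.
Proof.
  intros H. apply (Cder_unique f z); [|exact H].
  apply cderiv_correct. exists l. exact H.
Qed.

Lemma Cder_lipschitz (f : C -> C) (z l : C) : Cder f z l ->
  exists d, 0 < d /\ forall w, Cmod (w - z) < d ->
    Cmod (f w - f z) <= (Cmod l + 1) * Cmod (w - z).
Proof.
  intros H. apply Cder_eps with (e := 1) in H; [|lra].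
  destruct H as [d [Hd H]]. exists d. split; [exact Hd|].
  intros w Hw. specialize (H w Hw).
  generalize (Cmod_triangle (f w - f z - (w - z) * l) ((w - z) * l)).
  replace (f w - f z - (w - z) * l + (w - z) * l)%C with (f w - f z)%C by ring.
  rewrite Cmod_mult. lra.
Qed.

Lemma Cder_continuous (f : C -> C) (z l : C) : Cder f z l ->
  forall e, 0 < e -> exists d, 0 < d /\ forall w, Cmod (w - z) < d ->
    Cmod (f w - f z) < e.
Proof.
  intros H e He. destruct (Cder_lipschitz f z l H) as [d [Hd H']].
  generalize (Cmod_ge_0 l). intros Hl.
  assert (Hq : 0 < e / (Cmod l + 1)) by (apply Rdiv_lt_0_compat; lra).
  exists (Rmin d (e / (Cmod l + 1))).
  split; [apply Rmin_pos; assumption|]. intros w Hw.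
  apply Rle_lt_trans with (1 := H' w (Rlt_le_trans _ _ _ Hw (Rmin_l _ _))).
  assert (Hw' : Cmod (w - z) < e / (Cmod l + 1)) by
    (apply Rlt_le_trans with (1 := Hw), Rmin_r).
  apply Rmult_lt_compat_l with (r := Cmod l + 1) in Hw'; [|lra].
  replace ((Cmod l + 1) * (e / (Cmod l + 1))) with e in Hw' by (field; lra).
  exact Hw'.
Qed.

Lemma Cder_const (c z : C) : Cder (fun _ => c) z (RtoC 0).
Proof.
  apply Cder_eps. intros e He. exists 1. split; [lra|]. intros w _.
  replace (c - c - (w - z) * 0)%C with (RtoC 0) by ring. rewrite Cmod_0.
  apply Rmult_le_pos; [lra|apply Cmod_ge_0].
Qed.

Lemma Cder_id (z : C) : Cder (fun w => w) z (RtoC 1).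
Proof.
  apply Cder_eps. intros e He. exists 1. split; [lra|]. intros w _.
  replace (w - z - (w - z) * 1)%C with (RtoC 0) by ring. rewrite Cmod_0.
  apply Rmult_le_pos; [lra|apply Cmod_ge_0].
Qed.

Lemma Cder_minus (f g : C -> C) (z l m : C) :
  Cder f z l -> Cder g z m -> Cder (fun w => f w - g w)%C z (l - m)%C.
Proof. apply (is_derive_minus (K := C_AbsRing) (V := C_NormedModule)). Qed.

Lemma Cder_mult (f g : C -> C) (z l m : C) :
  Cder f z l -> Cder g z m ->
  Cder (fun w => f w * g w)%C z (l * g z + f z * m)%C.
Proof.
  intros Hf Hg.
  destruct (Cder_lipschitz g z m Hg) as [d3 [Hd3 H3]].
  rewrite Cder_eps in Hf, Hg. apply Cder_eps. intros e He.
  generalize (Cmod_ge_0 (g z)) (Cmod_ge_0 (f z)) (Cmod_ge_0 l) (Cmod_ge_0 m).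
  intros Hgz Hfz Hl Hm.
  (* The remainder of the product splits into four terms, each at most e' |w - z| times one of these
     coefficients; the extra 1 keeps N away from 0. *)
  set (N := Cmod (g z) + Cmod (f z) + Cmod l * (Cmod m + 1) + 1 + (Cmod m + 1)).
  assert (HN : 1 <= N).
  { unfold N. assert (0 <= Cmod l * (Cmod m + 1)) by (apply Rmult_le_pos; lra). lra. }
  set (e' := e / N).
  assert (He' : 0 < e') by (apply Rdiv_lt_0_compat; lra).
  assert (HeN : e' * N = e) by (unfold e'; field; lra).
  destruct (Hf e' He') as [d1 [Hd1 H1]].
  destruct (Hg e' He') as [d2 [Hd2 H2]].
  exists (Rmin (Rmin d1 d2) (Rmin d3 (Rmin 1 e'))).
  split; [repeat apply Rmin_pos; lra|]. intros w Hw.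
  apply Rmin_Rgt in Hw. destruct Hw as [Hw1 Hw2].
  apply Rmin_Rgt in Hw1. apply Rmin_Rgt in Hw2.
  destruct Hw1 as [W1 W2]. destruct Hw2 as [W3 Hw2].
  apply Rmin_Rgt in Hw2. destruct Hw2 as [W4 W5].
  specialize (H1 w W1). specialize (H2 w W2). specialize (H3 w W3).
  set (h := Cmod (w - z)) in *.
  assert (Hh : 0 <= h) by apply Cmod_ge_0.
  replace (f w * g w - f z * g z - (w - z) * (l * g z + f z * m))%C with
    ((f w - f z - (w - z) * l) * g z + (f z * (g w - g z - (w - z) * m)
     + ((f w - f z - (w - z) * l) * (g w - g z) + (w - z) * l * (g w - g z))))%C
    by ring.
  eapply Rle_trans; [apply Cmod_triangle|].
  eapply Rle_trans; [apply Rplus_le_compat_l, Cmod_triangle|].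
  eapply Rle_trans; [apply Rplus_le_compat_l, Rplus_le_compat_l, Cmod_triangle|].
  rewrite !Cmod_mult. fold h.
  generalize (Cmod_ge_0 (f w - f z - (w - z) * l)) (Cmod_ge_0 (g w - g z)
     ) (Cmod_ge_0 (g w - g z - (w - z) * m)).
  revert H1 H2 H3.
  generalize (Cmod (f w - f z - (w - z) * l)) as A.
  generalize (Cmod (g w - g z - (w - z) * m)) as B.
  generalize (Cmod (g w - g z)) as D.
  intros D B A H1 H2 H3 HA HD HB.
  assert (A * Cmod (g z) <= e' * h * Cmod (g z)) by (apply Rmult_le_compat_r; lra).
  assert (Cmod (f z) * B <= Cmod (f z) * (e' * h)) by (apply Rmult_le_compat_l; lra).
  assert (HD' : D <= (Cmod m + 1) * 1).
  { eapply Rle_trans; [apply H3|]. apply Rmult_le_compat_l; lra. }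
  assert (A * D <= e' * h * ((Cmod m + 1) * 1)) by (apply Rmult_le_compat; lra).
  assert (h * Cmod l * D <= h * Cmod l * ((Cmod m + 1) * e')).
  { apply Rmult_le_compat_l; [apply Rmult_le_pos; lra|].
    eapply Rle_trans; [apply H3|]. apply Rmult_le_compat_l; lra. }
  rewrite <- HeN. unfold N.
  assert (0 <= e' * h) by (apply Rmult_le_pos; lra).
  nra.
Qed.

Lemma Cder_inv (z : C) : z <> 0%C -> Cder (fun w => / w)%C z (- / (z * z))%C.
Proof.
  intros Hz. apply Cder_eps. intros e He.
  assert (Hm : 0 < Cmod z) by (apply Cmod_gt_0; exact Hz).
  set (m := Cmod z) in *.
  (* The first radius gives |w| >= m/2, so the remainder is at most |w - z|^2 divided by m^3/2; the
     second radius turns one factor |w - z| into e. *)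
  exists (Rmin (m / 2) (e * m ^ 3 / 2)).
  assert (0 < m ^ 3) by (apply pow_lt; exact Hm).
  split. { apply Rmin_pos; [lra|]. apply Rdiv_lt_0_compat; [|lra].
    apply Rmult_lt_0_compat; assumption. }
  intros w Hw. apply Rmin_Rgt in Hw. destruct Hw as [W1 W2].
  assert (Hwm : m / 2 <= Cmod w).
  { generalize (Cmod_triangle_inv z (z - w)).
    replace (z - (z - w))%C with w by ring.
    replace (z - w)%C with (- (w - z))%C by ring. rewrite Cmod_opp.
    fold m. lra. }
  assert (Hw0 : w <> 0%C) by (apply Cmod_gt_0; lra).
  replace (/ w - / z - (w - z) * - / (z * z))%C with
    ((w - z) * ((w - z) * / (z * z * w)))%C by (field; auto).
  rewrite !Cmod_mult, Cmod_inv, !Cmod_mult by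
    (repeat apply Cmult_neq_0; assumption).
  fold m. rewrite (Rmult_comm e). apply Rmult_le_compat_l; [apply Cmod_ge_0|].
  assert (0 < m * m) by nra.
  assert (Hp : 0 < m * m * Cmod w) by (apply Rmult_lt_0_compat; lra).
  apply Rmult_le_reg_r with (1 := Hp). rewrite Rmult_assoc, Rinv_l by lra.
  assert (m * m * (m / 2) <= m * m * Cmod w) by (apply Rmult_le_compat_l; lra).
  assert (e * (m * m * (m/2)) <= e * (m * m * Cmod w)) by
    (apply Rmult_le_compat_l; lra).
  nra.
Qed.

Lemma Cder_inv_comp (f : C -> C) (z l : C) : f z <> 0%C -> Cder f z l ->
  Cder (fun w => / f w)%C z (l * - / (f z * f z))%C.
Proof.
  intros Hz [_ H].
  apply (is_derive_comp (K := C_AbsRing) (V := C_NormedModule) (fun u => / u)%C f);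
    [apply Cder_inv; exact Hz|].
  (* [is_derive_comp] takes the inner derivative in the ring seen as a module over itself; the
     remainder estimate is the same, only linearity is supplied again. *)
  split; [apply is_linear_scal_l|exact H].
Qed.

(** * Continuity and derivatives along a real parameter *)

Lemma Rcont_pair (u : R -> C) (t : R) :
  continuous (fun s => fst (u s)) t -> continuous (fun s => snd (u s)) t ->
  Rcont u t.
Proof.
  intros H1 H2. apply filterlim_locally. intros e.
  apply filter_and.
  - apply (proj1 (filterlim_locally _ _) H1 e).
  - apply (proj1 (filterlim_locally _ _) H2 e).
Qed.

Lemma Rcont_fst (u : R -> C) (t : R) : Rcont u t -> continuous (fun s => fst (u s)) t.
Proof. intros H. apply (continuous_comp u fst); [exact H|apply continuous_fst]. Qed.

Lemma Rcont_snd (u : R -> C) (t : R) : Rcont u t -> continuous (fun s => snd (u s)) t.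
Proof. intros H. apply (continuous_comp u snd); [exact H|apply continuous_snd]. Qed.

Lemma Rcont_const (c : C) (t : R) : Rcont (fun _ => c) t.
Proof. apply continuous_const. Qed.

Lemma Rcont_RtoC (t : R) : Rcont RtoC t.
Proof. apply Rcont_pair; simpl; [apply continuous_id|apply continuous_const]. Qed.

Lemma Rcont_plus (u v : R -> C) (t : R) :
  Rcont u t -> Rcont v t -> Rcont (fun s => u s + v s)%C t.
Proof.
  intros Hu Hv. apply (continuous_plus (K := R_AbsRing) (V := C_R_NormedModule) u v);
  assumption.
Qed.

Lemma Rcont_minus (u v : R -> C) (t : R) :
  Rcont u t -> Rcont v t -> Rcont (fun s => u s - v s)%C t.
Proof.
  intros Hu Hv. apply (continuous_minus (K := R_AbsRing) (V := C_R_NormedModule) u v);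
  assumption.
Qed.

Lemma Rcont_mult (u v : R -> C) (t : R) :
  Rcont u t -> Rcont v t -> Rcont (fun s => u s * v s)%C t.
Proof.
  intros Hu Hv.
  generalize (Rcont_fst _ _ Hu) (Rcont_snd _ _ Hu) (Rcont_fst _ _ Hv) (Rcont_snd _ _ Hv).
  intros a b c d. apply Rcont_pair; simpl.
  - apply (continuous_minus (K := R_AbsRing) (V := R_NormedModule));
    apply (continuous_mult (K := R_AbsRing)); assumption.
  - apply (continuous_plus (K := R_AbsRing) (V := R_NormedModule));
    apply (continuous_mult (K := R_AbsRing)); assumption.
Qed.

Lemma Rcont_eps (u : R -> C) (t e : R) : Rcont u t -> 0 < e ->
  exists d, 0 < d /\ forall s, Rabs (s - t) < d -> Cmod (u s - u t) < e.
Proof.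
  intros H He.
  (* Balls of [C_UniformSpace] are squares: radius e/2 bounds the modulus only by sqrt 2 times e/2,
     which is still at most e. *)
  assert (He2 : 0 < e / 2) by lra.
  assert (H1 := proj1 (filterlim_locally _ _) H (mkposreal _ He2)).
  destruct H1 as [d Hd]. exists d. split; [apply cond_pos|].
  intros s Hs. apply Rlt_le_trans with (1 := C_NormedModule_mixin_compat2 _ _ _ (Hd s Hs)).
  simpl. assert (sqrt 2 <= 2).
  { rewrite <- (sqrt_Rsqr 2) at 2 by lra. apply sqrt_le_1_alt. unfold Rsqr. lra. }
  nra.
Qed.

Lemma Rcont_comp (f : C -> C) (u : R -> C) (t : R) :
  ex_Cder f (u t) ->
  Rcont u t -> Rcont (fun s => f (u s)) t.
Proof.
  intros [l Hl] Hu. apply filterlim_locally. intros e.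
  destruct (Cder_continuous f _ l Hl e (cond_pos e)) as [d [Hd H]].
  destruct (Rcont_eps u t d Hu Hd) as [d' [Hd' H']].
  exists (mkposreal d' Hd'). intros s Hs.
  apply C_NormedModule_mixin_compat1. apply H. apply H'. exact Hs.
Qed.

(** Over the reals, w = fst w times 1 plus snd w times i, so u is a sum of two real functions times
    fixed vectors. *)
Lemma Rder_pair (u : R -> C) (t : R) (l : C) :
  is_derive (fun s => fst (u s)) t (fst l) ->
  is_derive (fun s => snd (u s)) t (snd l) -> Rder u t l.
Proof.
  intros H1 H2.
  apply (is_derive_scal_l (V := C_R_NormedModule) _ _ _ (RtoC 1)) in H1.
  apply (is_derive_scal_l (V := C_R_NormedModule) _ _ _ Ci) in H2.
  generalize (is_derive_plus (K := R_AbsRing) (V := C_R_NormedModule)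
    _ _ _ _ _ H1 H2).
  assert (E : forall w : C, plus (G := C_R_NormedModule)
    (scal (V := C_R_NormedModule) (fst w) (RtoC 1))
    (scal (V := C_R_NormedModule) (snd w) Ci) = w).
  { intros [x y]. unfold plus, scal; simpl.
    unfold prod_plus, prod_scal, plus, scal; simpl. unfold mult; simpl.
    f_equal; ring. }
  rewrite E. apply is_derive_ext. intros s. apply E.
Qed.

Lemma Rder_fst (u : R -> C) (t : R) (l : C) :
  Rder u t l -> is_derive (fun s => fst (u s)) t (fst l).
Proof.
  intros H.
  apply (filterdiff_comp (K := R_AbsRing) (U := R_NormedModule) (V := C_R_NormedModule)
    (W := R_NormedModule) u (fun w => fst w) _ (fun w => fst w) H).
  apply filterdiff_linear, is_linear_fst.
Qed.

Lemma Rder_snd (u : R -> C) (t : R) (l : C) :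
  Rder u t l -> is_derive (fun s => snd (u s)) t (snd l).
Proof.
  intros H.
  apply (filterdiff_comp (K := R_AbsRing) (U := R_NormedModule) (V := C_R_NormedModule)
    (W := R_NormedModule) u (fun w => snd w) _ (fun w => snd w) H).
  apply filterdiff_linear, is_linear_snd.
Qed.

Lemma Rder_const (c : C) (t : R) : Rder (fun _ => c) t (RtoC 0).
Proof. apply (is_derive_const (K := R_AbsRing) (V := C_R_NormedModule)). Qed.

Lemma Rder_RtoC (t : R) : Rder RtoC t (RtoC 1).
Proof. apply Rder_pair; simpl; auto_derive; auto. Qed.

Lemma Rder_plus (u v : R -> C) (t : R) (l m : C) :
  Rder u t l -> Rder v t m -> Rder (fun s => u s + v s)%C t (l + m)%C.
Proof. apply (is_derive_plus (K := R_AbsRing) (V := C_R_NormedModule)). Qed.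

Lemma Rder_minus (u v : R -> C) (t : R) (l m : C) :
  Rder u t l -> Rder v t m -> Rder (fun s => u s - v s)%C t (l - m)%C.
Proof. apply (is_derive_minus (K := R_AbsRing) (V := C_R_NormedModule)). Qed.

Lemma Rder_mult (u v : R -> C) (t : R) (l m : C) :
  Rder u t l -> Rder v t m -> Rder (fun s => u s * v s)%C t (l * v t + u t * m)%C.
Proof.
  intros Hu Hv.
  generalize (Rder_fst _ _ _ Hu) (Rder_snd _ _ _ Hu) (Rder_fst _ _ _ Hv) (Rder_snd _ _ _ Hv).
  intros a b c d. apply Rder_pair; simpl.
  - evar_last.
    + apply (is_derive_minus (K := R_AbsRing) (V := R_NormedModule));
      apply (is_derive_mult (K := R_AbsRing)); try eassumption; exact Rmult_comm.
    + unfold minus, plus, opp, mult; simpl. ring.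
  - evar_last.
    + apply (is_derive_plus (K := R_AbsRing) (V := R_NormedModule));
      apply (is_derive_mult (K := R_AbsRing)); try eassumption; exact Rmult_comm.
    + unfold plus, mult; simpl. ring.
Qed.

Lemma Rder_continuous (u : R -> C) (t : R) (l : C) : Rder u t l -> Rcont u t.
Proof.
  intros H. apply (ex_derive_continuous (K := R_AbsRing) (V := C_R_NormedModule)).
  exists l. exact H.
Qed.

(** * Integrals of complex functions of a real variable *)

Lemma ex_CInt (u : R -> C) (a b : R) : a <= b ->
  (forall t, a <= t <= b -> Rcont u t) ->
  ex_RInt (V := C_R_NormedModule) u a b.
Proof.
  intros Hab H. apply (ex_RInt_continuous (V := C_R_CompleteNormedModule)).
  rewrite Rmin_left, Rmax_right by exact Hab. exact H.
Qed.

Lemma is_CInt (u : R -> C) (a b : R) : a <= b ->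
  (forall t, a <= t <= b -> Rcont u t) ->
  is_RInt (V := C_R_NormedModule) u a b (CInt u a b).
Proof.
  intros Hab H. apply (RInt_correct (V := C_R_CompleteNormedModule)).
  apply ex_CInt; assumption.
Qed.

Lemma CInt_unique (u : R -> C) (a b : R) (l : C) :
  is_RInt (V := C_R_NormedModule) u a b l -> CInt u a b = l.
Proof. apply (is_RInt_unique (V := C_R_CompleteNormedModule)). Qed.

Lemma CInt_ext (u v : R -> C) (a b : R) : a <= b ->
  (forall t, a <= t <= b -> u t = v t) -> CInt u a b = CInt v a b.
Proof.
  intros Hab H. apply (RInt_ext (V := C_R_CompleteNormedModule)).
  rewrite Rmin_left, Rmax_right by exact Hab. intros t Ht. apply H. lra.
Qed.

Lemma CInt_Chasles (u : R -> C) (a b c : R) : a <= b -> b <= c ->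
  (forall t, a <= t <= c -> Rcont u t) ->
  CInt u a c = (CInt u a b + CInt u b c)%C.
Proof.
  intros Hab Hbc H. symmetry.
  apply (RInt_Chasles (V := C_R_CompleteNormedModule) u a b c);
  apply ex_CInt; try lra; intros t Ht; apply H; lra.
Qed.

Lemma CInt_minus (u v : R -> C) (a b : R) : a <= b ->
  (forall t, a <= t <= b -> Rcont u t) -> (forall t, a <= t <= b -> Rcont v t) ->
  CInt (fun t => u t - v t)%C a b = (CInt u a b - CInt v a b)%C.
Proof.
  intros Hab Hu Hv. apply (RInt_minus (V := C_R_CompleteNormedModule) u v);
  apply ex_CInt; assumption.
Qed.

(** The integral lives in a real normed module, where a complex c is not a scalar; hence the passage
    through real and imaginary parts. *)
Lemma CInt_mult_l (c : C) (u : R -> C) (a b : R) : a <= b ->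
  (forall t, a <= t <= b -> Rcont u t) ->
  CInt (fun t => c * u t)%C a b = (c * CInt u a b)%C.
Proof.
  intros Hab Hu. apply CInt_unique.
  generalize (is_CInt u a b Hab Hu). generalize (CInt u a b). intros l Hl.
  apply (is_RInt_fct_extend_pair (U := R_NormedModule) (V := R_NormedModule));
  generalize (is_RInt_fct_extend_fst (U := R_NormedModule) (V := R_NormedModule) _ _ _ _ Hl)
    (is_RInt_fct_extend_snd (U := R_NormedModule) (V := R_NormedModule) _ _ _ _ Hl);
  intros H1 H2.
  - apply (is_RInt_minus (V := R_NormedModule));
    apply (is_RInt_scal (V := R_NormedModule)); assumption.
  - apply (is_RInt_plus (V := R_NormedModule));
    apply (is_RInt_scal (V := R_NormedModule)); assumption.
Qed.

Lemma CInt_bound (u : R -> C) (a b M : R) : a <= b ->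
  (forall t, a <= t <= b -> Rcont u t) ->
  (forall t, a <= t <= b -> Cmod (u t) <= M) ->
  Cmod (CInt u a b) <= (b - a) * M.
Proof.
  intros Hab Hu HM. rewrite Cmod_norm.
  apply (norm_RInt_le_const (V := C_R_NormedModule) u a b); [exact Hab| |].
  - intros t Ht. rewrite <- Cmod_norm. apply HM. exact Ht.
  - apply is_CInt; assumption.
Qed.

Lemma CInt_derive (u du : R -> C) (a b : R) : a <= b ->
  (forall t, a <= t <= b -> Rder u t (du t)) ->
  (forall t, a <= t <= b -> Rcont du t) ->
  CInt du a b = (u b - u a)%C.
Proof.
  intros Hab Hu Hdu. apply CInt_unique.
  apply (is_RInt_derive (V := C_R_CompleteNormedModule) u du);
  rewrite Rmin_left, Rmax_right by exact Hab; assumption.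
Qed.

Lemma CInt_const (c : C) (a b : R) : CInt (fun _ => c) a b = (RtoC (b - a) * c)%C.
Proof.
  apply CInt_unique. replace (RtoC (b - a) * c)%C with
    (scal (V := C_R_NormedModule) (b - a) c).
  - apply (is_RInt_const (V := C_R_NormedModule)).
  - unfold scal; simpl. unfold prod_scal, scal; simpl. unfold mult; simpl.
    unfold Cmult; simpl. f_equal; ring.
Qed.

(** * Goursat's theorem on a parameter rectangle *)

(** The point is the supremum of the left ends, since every right end bounds all of them. *)
Lemma nested_intervals (a b : nat -> R) :
  (forall n, a n <= a (S n)) -> (forall n, b (S n) <= b n) ->
  (forall n, a n <= b n) -> exists p, forall n, a n <= p <= b n.
Proof.
  intros Ha Hb Hab.
  assert (Ma : forall n m, (n <= m)%nat -> a n <= a m).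
  { intros n m H. induction H; [lra|]. specialize (Ha m). lra. }
  assert (Mb : forall n m, (n <= m)%nat -> b m <= b n).
  { intros n m H. induction H; [lra|]. specialize (Hb m). lra. }
  assert (Hnm : forall n m, a n <= b m).
  { intros n m. apply Rle_trans with (a (max n m)); [apply Ma; lia|].
    apply Rle_trans with (b (max n m)); [apply Hab|apply Mb; lia]. }
  destruct (completeness (fun x => exists n, x = a n)) as [p [H1 H2]].
  - exists (b O). intros x [n ->]. apply Hnm.
  - exists (a O), O. reflexivity.
  - exists p. intros n. split.
    + apply H1. exists n. reflexivity.
    + apply H2. intros x [m ->]. apply Hnm.
Qed.

(** A pair codes an interval by its end points, so a parameter rectangle is a pair of pairs. *)
Definition left_child (x : R * R) : R * R := (fst x, (fst x + snd x) / 2).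
Definition right_child (x : R * R) : R * R := ((fst x + snd x) / 2, snd x).

Definition half_of (x y : R * R) : Prop := y = left_child x \/ y = right_child x.

Lemma half_of_nested (x y : R * R) : half_of x y -> fst x <= snd x ->
  fst x <= fst y /\ snd y <= snd x /\ snd y - fst y = (snd x - fst x) / 2.
Proof. intros [-> | ->] H; simpl; lra. Qed.

Lemma nested_halves (x : nat -> R * R) :
  fst (x O) < snd (x O) -> (forall n, half_of (x n) (x (S n))) ->
  (forall n, snd (x n) - fst (x n) = (snd (x O) - fst (x O)) / 2 ^ n) /\
  (forall n, fst (x O) <= fst (x n) < snd (x n) /\ snd (x n) <= snd (x O)) /\
  exists p, forall n, fst (x n) <= p <= snd (x n).
Proof.
  intros H0 H.
  assert (L : forall n, snd (x n) - fst (x n) = (snd (x O) - fst (x O)) / 2 ^ n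
    /\ fst (x O) <= fst (x n) < snd (x n) /\ snd (x n) <= snd (x O)).
  { induction n as [|n [IH1 IH2]].
    - simpl. lra.
    - destruct (half_of_nested _ _ (H n)) as [A [B D]]; [lra|].
      split; [|lra]. rewrite D, IH1. simpl. field. apply pow_nonzero. lra. }
  split; [apply L|]. split; [apply L|].
  apply nested_intervals; intros n; destruct (L n) as [_ Ln];
  try (destruct (half_of_nested _ _ (H n)) as [A [B D]]); lra.
Qed.

(** The combinatorial half of Goursat, for any additive function J of rectangles. If J is not 0,
    some quarter always keeps at least a quarter of the modulus, so |J| >= |J x0 y0| / 4^n along a
    nested sequence; near the common point J is o of the squared size, which also shrinks like 1 /
    4^n. *)
Lemma quadrisection (J : R * R -> R * R -> C) (x0 y0 : R * R) :
  fst x0 < snd x0 -> fst y0 < snd y0 ->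
  (forall x y, fst x0 <= fst x < snd x -> snd x <= snd x0 ->
     fst y0 <= fst y < snd y -> snd y <= snd y0 ->
     J x y = (J (left_child x) (left_child y) + J (right_child x) (left_child y)
       + (J (left_child x) (right_child y) + J (right_child x) (right_child y)))%C) ->
  (forall p q, fst x0 <= p <= snd x0 -> fst y0 <= q <= snd y0 ->
     forall e, 0 < e -> exists d, 0 < d /\ forall x y,
       fst x0 <= fst x < snd x -> snd x <= snd x0 ->
       fst y0 <= fst y < snd y -> snd y <= snd y0 ->
       fst x <= p <= snd x -> fst y <= q <= snd y ->
       snd x - fst x < d -> snd y - fst y < d ->
       Cmod (J x y) <= e * ((snd x - fst x) + (snd y - fst y)) ^ 2) ->
  J x0 y0 = 0%C.
Proof.
  intros Hx0 Hy0 Hadd Hloc.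
  apply Cmod_eq_0. destruct (Rle_lt_dec (Cmod (J x0 y0)) 0) as [H|H].
  { generalize (Cmod_ge_0 (J x0 y0)). lra. }
  exfalso.
  set (valid := fun r : (R * R) * (R * R) =>
    (fst x0 <= fst (fst r) < snd (fst r) /\ snd (fst r) <= snd x0) /\
    (fst y0 <= fst (snd r) < snd (snd r) /\ snd (snd r) <= snd y0)).
  assert (Hstep : forall r, valid r -> exists r',
    half_of (fst r) (fst r') /\ half_of (snd r) (snd r') /\
    Cmod (J (fst r) (snd r)) <= 4 * Cmod (J (fst r') (snd r'))).
  { intros [x y] [[V1 V2] [V3 V4]]. simpl in *.
    specialize (Hadd x y V1 V2 V3 V4).
    destruct (classic (exists r', half_of x (fst r') /\ half_of y (snd r') /\
      Cmod (J x y) <= 4 * Cmod (J (fst r') (snd r')))) as [E|E]; [exact E|].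
    exfalso.
    assert (N : forall u v, half_of x u -> half_of y v ->
      4 * Cmod (J u v) < Cmod (J x y)).
    { intros u v Hu Hv. apply Rnot_le_lt. intros K. apply E. exists (u, v). auto. }
    generalize (N (left_child x) (left_child y) (or_introl eq_refl) (or_introl eq_refl))
     (N (right_child x) (left_child y) (or_intror eq_refl) (or_introl eq_refl))
     (N (left_child x) (right_child y) (or_introl eq_refl) (or_intror eq_refl))
     (N (right_child x) (right_child y) (or_intror eq_refl) (or_intror eq_refl)).
    apply (f_equal Cmod) in Hadd. revert Hadd.
    generalize (J (left_child x) (left_child y)) (J (right_child x) (left_child y))
     (J (left_child x) (right_child y)) (J (right_child x) (right_child y)).
    intros c1 c2 c3 c4 Hc. generalize (Cmod_triangle (c1 + c2) (c3 + c4))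
      (Cmod_triangle c1 c2) (Cmod_triangle c3 c4). lra. }
  (* A choice of a heavy quarter; it is meaningful only on [valid] rectangles, so validity is
     carried along the iteration. *)
  set (step := fun r => epsilon (inhabits r) (fun r' =>
    half_of (fst r) (fst r') /\ half_of (snd r) (snd r') /\
    Cmod (J (fst r) (snd r)) <= 4 * Cmod (J (fst r') (snd r')))).
  set (r := fun n => Nat.iter n step (x0, y0)).
  assert (Hr : forall n, valid (r n) /\
    half_of (fst (r n)) (fst (r (S n))) /\ half_of (snd (r n)) (snd (r (S n))) /\
    Cmod (J (fst (r n)) (snd (r n))) <= 4 * Cmod (J (fst (r (S n))) (snd (r (S n))))).
  { assert (HS : forall n, valid (r n) ->
      half_of (fst (r n)) (fst (r (S n))) /\ half_of (snd (r n)) (snd (r (S n))) /\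
      Cmod (J (fst (r n)) (snd (r n))) <= 4 * Cmod (J (fst (r (S n))) (snd (r (S n))))).
    { intros n Hn. change (r (S n)) with (step (r n)). unfold step.
      apply epsilon_spec. apply Hstep. exact Hn. }
    assert (HV : forall n, valid (r n)).
    { induction n as [|n IH].
      - unfold valid; simpl. lra.
      - destruct (HS n IH) as [A [B _]]. unfold valid in *.
        apply half_of_nested in A; [|lra]. apply half_of_nested in B; [|lra]. lra. }
    intros n. split; [apply HV|apply HS, HV]. }
  destruct (nested_halves (fun n => fst (r n))) as [Lx [Bx [p Hp]]];
    [exact Hx0|apply Hr|].
  destruct (nested_halves (fun n => snd (r n))) as [Ly [By [q Hq]]];
    [exact Hy0|apply Hr|].
  change (fst (r O)) with x0 in *. change (snd (r O)) with y0 in *.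
  assert (HJ : forall n, Cmod (J x0 y0) <= 4 ^ n * Cmod (J (fst (r n)) (snd (r n)))).
  { induction n as [|n IH]; [simpl; lra|].
    destruct (Hr n) as [_ [_ [_ K]]].
    assert (0 < 4 ^ n) by (apply pow_lt; lra).
    apply Rmult_le_compat_l with (r := 4 ^ n) in K; [|lra].
    change (4 ^ S n) with (4 * 4 ^ n). lra. }
  set (l := (snd x0 - fst x0) + (snd y0 - fst y0)).
  assert (Hl : 0 < l) by (unfold l; lra).
  assert (Hl2 : 0 < l ^ 2) by (apply pow_lt; exact Hl).
  (* With this e the bound at size l / 2^n is half of |J x0 y0| / 4^n, contradicting the lower
     bound. *)
  destruct (Hloc p q) with (e := Cmod (J x0 y0) / (2 * l ^ 2)) as [d [Hd Hb]].
  - generalize (Hp O). simpl. lra.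
  - generalize (Hq O). simpl. lra.
  - apply Rdiv_lt_0_compat; lra.
  - destruct (pow_lt_1_zero (1 / 2)) with (y := d / l) as [n Hn].
    + rewrite Rabs_right; lra.
    + apply Rdiv_lt_0_compat; lra.
    + specialize (Hn n (le_n n)).
      assert (H2 : 0 < 2 ^ n) by (apply pow_lt; lra).
      assert (Hs : l / 2 ^ n < d).
      { replace (1 / 2) with (/ 2) in Hn by lra. rewrite pow_inv in Hn.
        rewrite Rabs_right in Hn by (left; apply Rinv_0_lt_compat; exact H2).
        apply Rmult_lt_compat_r with (r := l) in Hn; [|exact Hl].
        replace (d / l * l) with d in Hn by (field; lra). lra. }
      destruct (Hr n) as [[V1 V2] _].
      assert (Sum : (snd (fst (r n)) - fst (fst (r n))) +
        (snd (snd (r n)) - fst (snd (r n))) = l / 2 ^ n).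
      { rewrite Lx, Ly. unfold l. field. lra. }
      specialize (Hb (fst (r n)) (snd (r n))). rewrite Sum in Hb.
      assert (Cmod (J (fst (r n)) (snd (r n))) <=
        Cmod (J x0 y0) / (2 * l ^ 2) * (l / 2 ^ n) ^ 2).
      { apply Hb; try apply V1; try apply V2; try apply Hp; try apply Hq; lra. }
      specialize (HJ n).
      replace (Cmod (J x0 y0) / (2 * l ^ 2) * (l / 2 ^ n) ^ 2) with
        (Cmod (J x0 y0) / 2 / 4 ^ n) in H0.
      * assert (0 < 4 ^ n) by (apply pow_lt; lra).
        apply Rmult_le_compat_l with (r := 4 ^ n) in H0; [|lra].
        replace (4 ^ n * (Cmod (J x0 y0) / 2 / 4 ^ n)) with (Cmod (J x0 y0) / 2)
          in H0 by (field; lra). lra.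
      * replace 4 with (2 * 2) by ring. rewrite Rpow_mult_distr. field. lra.
Qed.

Lemma Lipschitz_of_Rder (u du : R -> C) (a b L s p : R) :
  (forall t, a <= t <= b -> Rder u t (du t)) ->
  (forall t, a <= t <= b -> Rcont du t) ->
  (forall t, a <= t <= b -> Cmod (du t) <= L) ->
  a <= s <= b -> a <= p <= b -> Cmod (u s - u p) <= L * Rabs (s - p).
Proof.
  intros Hu Hc HL Hs Hp.
  assert (W : forall x y, a <= x -> x <= y -> y <= b ->
    Cmod (u y - u x) <= L * (y - x)).
  { intros x y Hx Hxy Hy. rewrite <- (CInt_derive u du x y), Rmult_comm; try assumption.
    - apply CInt_bound; [assumption| |]; intros t Ht; [apply Hc|apply HL]; lra.
    - intros t Ht. apply Hu. lra.
    - intros t Ht. apply Hc. lra. }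
  destruct (Rle_dec p s) as [H|H].
  - rewrite Rabs_right by lra. apply W; lra.
  - rewrite Rabs_left by lra. replace (u s - u p)%C with (- (u p - u s))%C by ring.
    rewrite Cmod_opp. replace (- (s - p)) with (p - s) by ring. apply W; lra.
Qed.

(** Along any path the affine function v + (w - w0) l integrates to the end point difference of its
    primitive v w + (l/2)(w - w0)^2. What is left is the deviation of f from it, at most m, times
    the speed, at most L. *)
Lemma CInt_affine_error (f : C -> C) (u du : R -> C) (a b m L : R) (w0 v l : C) :
  a <= b -> 0 <= m ->
  (forall t, a <= t <= b -> ex_Cder f (u t)) ->
  (forall t, a <= t <= b -> Rder u t (du t)) ->
  (forall t, a <= t <= b -> Rcont du t) ->
  (forall t, a <= t <= b -> Cmod (du t) <= L) ->
  (forall t, a <= t <= b -> Cmod (f (u t) - v - (u t - w0) * l) <= m) ->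
  Cmod (CInt (fun t => f (u t) * du t)%C a b
    - ((v * u b + l / 2 * ((u b - w0) * (u b - w0)))
      - (v * u a + l / 2 * ((u a - w0) * (u a - w0)))))%C <= (b - a) * (m * L).
Proof.
  intros Hab Hm Hf Hu Hc HL He.
  assert (Hfu : forall t, a <= t <= b -> Rcont (fun s => f (u s)) t).
  { intros t Ht. apply Rcont_comp; [apply Hf, Ht|].
    apply Rder_continuous with (du t). apply Hu, Ht. }
  assert (Cu : forall t, a <= t <= b -> Rcont u t).
  { intros t Ht. apply Rder_continuous with (du t). apply Hu, Ht. }
  assert (Caff : forall t, a <= t <= b -> Rcont (fun s => (v + (u s - w0) * l) * du s)%C t).
  { intros t Ht. apply Rcont_mult; [|apply Hc, Ht].
    apply Rcont_plus; [apply Rcont_const|].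
    apply Rcont_mult; [|apply Rcont_const].
    apply Rcont_minus; [apply Cu, Ht|apply Rcont_const]. }
  rewrite <- (CInt_derive
    (fun t => v * u t + l / 2 * ((u t - w0) * (u t - w0)))%C
    (fun t => (v + (u t - w0) * l) * du t)%C a b Hab).
  - rewrite <- CInt_minus; try assumption.
    + apply CInt_bound; [assumption| |].
      * intros t Ht. apply Rcont_minus; [|apply Caff, Ht].
        apply Rcont_mult; [apply Hfu, Ht|apply Hc, Ht].
      * intros t Ht.
        replace (f (u t) * du t - (v + (u t - w0) * l) * du t)%C with
          ((f (u t) - v - (u t - w0) * l) * du t)%C by ring.
        rewrite Cmod_mult. apply Rmult_le_compat; try apply Cmod_ge_0;
        [apply He|apply HL]; exact Ht.
    + intros t Ht. apply Rcont_mult; [apply Hfu, Ht|apply Hc, Ht].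
  - intros t Ht. evar_last.
    + apply Rder_plus; apply Rder_mult;
      [apply Rder_const|apply Hu, Ht|apply Rder_const|].
      apply Rder_mult; apply Rder_minus;
      [apply Hu, Ht|apply Rder_const|apply Hu, Ht|apply Rder_const].
    + simpl. field.
  - exact Caff.
Qed.

(** S and T are the partial derivatives of P. The boundary integral is written as bottom plus right
    equals top plus left, so that no side is reversed and equal sides can be cancelled directly.
    Near a parameter point f is replaced by its affine part, whose primitive contributes only corner
    values of P, and these cancel whatever the shape of P. *)
Lemma goursat (f : C -> C) (P S T : R -> R -> C) (x0 y0 : R * R) (L : R) :
  fst x0 < snd x0 -> fst y0 < snd y0 ->
  (forall s t, Rder (fun s' => P s' t) s (S s t)) ->
  (forall s t, Rder (fun t' => P s t') t (T s t)) ->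
  (forall s t, Rcont (fun s' => S s' t) s) ->
  (forall s t, Rcont (fun t' => T s t') t) ->
  (forall s t, fst x0 <= s <= snd x0 -> fst y0 <= t <= snd y0 ->
    Cmod (S s t) <= L /\ Cmod (T s t) <= L /\
    ex_Cder f (P s t)) ->
  (CInt (fun s => f (P s (fst y0)) * S s (fst y0)) (fst x0) (snd x0)
   + CInt (fun t => f (P (snd x0) t) * T (snd x0) t) (fst y0) (snd y0) =
   CInt (fun s => f (P s (snd y0)) * S s (snd y0)) (fst x0) (snd x0)
   + CInt (fun t => f (P (fst x0) t) * T (fst x0) t) (fst y0) (snd y0))%C.
Proof.
  intros Hx0 Hy0 HS HT CS CT Hrect.
  set (X := fun (x : R * R) (t : R) =>
    CInt (fun s => f (P s t) * S s t)%C (fst x) (snd x)).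
  set (Y := fun (s : R) (y : R * R) =>
    CInt (fun t => f (P s t) * T s t)%C (fst y) (snd y)).
  change (X x0 (fst y0) + Y (snd x0) y0 = X x0 (snd y0) + Y (fst x0) y0)%C.
  assert (CX : forall s t, fst x0 <= s <= snd x0 -> fst y0 <= t <= snd y0 ->
    Rcont (fun s' => f (P s' t) * S s' t)%C s).
  { intros s t Hs Ht. apply Rcont_mult; [|apply CS].
    apply (Rcont_comp f (fun s' => P s' t)); [apply Hrect; assumption|].
    apply Rder_continuous with (S s t). apply HS. }
  assert (CY : forall s t, fst x0 <= s <= snd x0 -> fst y0 <= t <= snd y0 ->
    Rcont (fun t' => f (P s t') * T s t')%C t).
  { intros s t Hs Ht. apply Rcont_mult; [|apply CT].
    apply (Rcont_comp f (fun t' => P s t')); [apply Hrect; assumption|].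
    apply Rder_continuous with (T s t). apply HT. }
  assert (HL : 0 <= L).
  { destruct (Hrect (fst x0) (fst y0)) as [H _]; try lra.
    generalize (Cmod_ge_0 (S (fst x0) (fst y0))). lra. }
  set (J := fun x y => (X x (fst y) + Y (snd x) y - X x (snd y) - Y (fst x) y)%C).
  assert (HJ : J x0 y0 = 0%C).
  { apply quadrisection; try assumption.
    - intros x y [Hx1 Hx2] Hx3 [Hy1 Hy2] Hy3. unfold J. simpl.
      assert (EX : forall t, fst y0 <= t <= snd y0 ->
        X x t = (X (left_child x) t + X (right_child x) t)%C).
      { intros t Ht. unfold X; simpl. apply CInt_Chasles; try lra.
        intros s Hs. apply CX; lra. }
      assert (EY : forall s, fst x0 <= s <= snd x0 ->
        Y s y = (Y s (left_child y) + Y s (right_child y))%C).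
      { intros s Hs. unfold Y; simpl. apply CInt_Chasles; try lra.
        intros t Ht. apply CY; lra. }
      rewrite (EX (fst y)), (EX (snd y)), (EY (fst x)), (EY (snd x)) by lra.
      ring.
    - intros p q Hp Hq e He.
      destruct (Hrect p q Hp Hq) as [_ [_ [l Hl]]].
      (* On a rectangle of half-perimeter w the map P moves by at most L w, and the four sides have
         total parameter length 2 w, so the errors sum to e' times 2 L^2 w^2. Since w <= 2 d', the
         factor 2 L + 1 keeps P within d; both summands 1 cover L = 0. *)
      assert (HM : 0 < 2 * L * L + 1) by nra.
      assert (He' : 0 < e / (2 * L * L + 1)) by (apply Rdiv_lt_0_compat; assumption).
      destruct (proj1 (Cder_eps f (P p q) l) Hl _ He') as [d [Hd Hf]].
      set (e' := e / (2 * L * L + 1)) in *.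
      exists (d / (2 * L + 1)).
      assert (Hd' : 0 < d / (2 * L + 1)) by (apply Rdiv_lt_0_compat; lra).
      split; [exact Hd'|].
      assert (EL : d = (2 * L + 1) * (d / (2 * L + 1))) by (field; lra).
      set (d' := d / (2 * L + 1)) in *.
      intros x y [Hx1 Hx2] Hx3 [Hy1 Hy2] Hy3 Hpx Hqy Hxd Hyd.
      set (w := (snd x - fst x) + (snd y - fst y)).
      assert (Hw : 0 < w) by (unfold w; lra).
      assert (HP : forall s t, fst x <= s <= snd x -> fst y <= t <= snd y ->
        Cmod (P s t - P p q) <= L * w).
      { intros s t Hs Ht.
        replace (P s t - P p q)%C with ((P s t - P p t) + (P p t - P p q))%C by ring.
        eapply Rle_trans; [apply Cmod_triangle|].
        eapply Rle_trans; [apply Rplus_le_compat|].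
        - apply (Lipschitz_of_Rder (fun s' => P s' t) (fun s' => S s' t)
            (fst x) (snd x) L); try (intros; first [apply HS|apply CS]); try assumption.
          intros s' Hs'. apply Hrect; lra.
        - apply (Lipschitz_of_Rder (fun t' => P p t') (fun t' => T p t')
            (fst y) (snd y) L); try (intros; first [apply HT|apply CT]); try assumption.
          intros t' Ht'. apply Hrect; lra.
        - rewrite <- Rmult_plus_distr_l. apply Rmult_le_compat_l; [exact HL|].
          unfold w. apply Rplus_le_compat; apply Rabs_le; lra. }
      assert (HE : forall s t, fst x <= s <= snd x -> fst y <= t <= snd y ->
        Cmod (f (P s t) - f (P p q) - (P s t - P p q) * l) <= e' * (L * w)).
      { intros s t Hs Ht. eapply Rle_trans; [apply Hf|].
        - apply Rle_lt_trans with (1 := HP s t Hs Ht). rewrite EL.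
          assert (w <= 2 * d') by (unfold w; lra).
          apply Rle_lt_trans with (L * (2 * d')); [apply Rmult_le_compat_l; lra|]. lra.
        - apply Rmult_le_compat_l; [lra|]. apply HP; assumption. }
      assert (Hm : 0 <= e' * (L * w)) by (apply Rmult_le_pos; [lra|apply Rmult_le_pos; lra]).
      (* The conclusion left as [_] is read off from the instance of [CInt_affine_error] given as
         the proof. *)
      assert (BX : forall t, fst y <= t <= snd y -> _) by
       (exact (fun t (Ht : fst y <= t <= snd y) =>
        CInt_affine_error f (fun s => P s t) (fun s => S s t) (fst x) (snd x)
          (e' * (L * w)) L (P p q) (f (P p q)) l ltac:(lra) Hm
          (fun s Hs => proj2 (proj2 (Hrect s t ltac:(lra) ltac:(lra))))
          (fun s _ => HS s t) (fun s _ => CS s t)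
          (fun s Hs => proj1 (Hrect s t ltac:(lra) ltac:(lra)))
          (fun s Hs => HE s t Hs Ht))).
      assert (BY : forall s, fst x <= s <= snd x -> _) by
       (exact (fun s (Hs : fst x <= s <= snd x) =>
        CInt_affine_error f (fun t => P s t) (fun t => T s t) (fst y) (snd y)
          (e' * (L * w)) L (P p q) (f (P p q)) l ltac:(lra) Hm
          (fun t Ht => proj2 (proj2 (Hrect s t ltac:(lra) ltac:(lra))))
          (fun t _ => HT s t) (fun t _ => CT s t)
          (fun t Ht => proj1 (proj2 (Hrect s t ltac:(lra) ltac:(lra))))
          (fun t Ht => HE s t Hs Ht))).
      assert (B1 := BX (fst y) ltac:(lra)). assert (B2 := BX (snd y) ltac:(lra)).
      assert (B3 := BY (fst x) ltac:(lra)). assert (B4 := BY (snd x) ltac:(lra)).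
      cbv beta in B1, B2, B3, B4.
      fold (X x (fst y)) in B1. fold (X x (snd y)) in B2.
      fold (Y (fst x) y) in B3. fold (Y (snd x) y) in B4.
      set (G := fun z : C => (f (P p q) * z + l / 2 * ((z - P p q) * (z - P p q)))%C).
      change (Cmod (X x (fst y) - (G (P (snd x) (fst y)) - G (P (fst x) (fst y))))
        <= (snd x - fst x) * (e' * (L * w) * L)) in B1.
      change (Cmod (X x (snd y) - (G (P (snd x) (snd y)) - G (P (fst x) (snd y))))
        <= (snd x - fst x) * (e' * (L * w) * L)) in B2.
      change (Cmod (Y (fst x) y - (G (P (fst x) (snd y)) - G (P (fst x) (fst y))))
        <= (snd y - fst y) * (e' * (L * w) * L)) in B3.
      change (Cmod (Y (snd x) y - (G (P (snd x) (snd y)) - G (P (snd x) (fst y))))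
        <= (snd y - fst y) * (e' * (L * w) * L)) in B4.
      assert (BJ : Cmod (J x y) <= 2 * w * (e' * (L * w) * L)).
      { unfold J.
        (* The values of the primitive G at the four corners cancel around the boundary. *)
        replace (X x (fst y) + Y (snd x) y - X x (snd y) - Y (fst x) y)%C with
          ((X x (fst y) - (G (P (snd x) (fst y)) - G (P (fst x) (fst y))))
          + (Y (snd x) y - (G (P (snd x) (snd y)) - G (P (snd x) (fst y))))
          - (X x (snd y) - (G (P (snd x) (snd y)) - G (P (fst x) (snd y))))
          - (Y (fst x) y - (G (P (fst x) (snd y)) - G (P (fst x) (fst y)))))%C by ring.
        eapply Rle_trans; [apply Cmod_triangle_sub|].
        eapply Rle_trans; [apply Rplus_le_compat_r, Cmod_triangle_sub|].
        eapply Rle_trans; [apply Rplus_le_compat_r, Rplus_le_compat_r, Cmod_triangle|].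
        replace (2 * w * (e' * (L * w) * L)) with
          ((snd x - fst x) * (e' * (L * w) * L) + (snd y - fst y) * (e' * (L * w) * L)
          + (snd x - fst x) * (e' * (L * w) * L) + (snd y - fst y) * (e' * (L * w) * L))
          by (unfold w; ring).
        lra. }
      apply Rle_trans with (1 := BJ).
      replace (2 * w * (e' * (L * w) * L)) with (e' * (2 * L * L) * w ^ 2) by ring.
      apply Rmult_le_compat_r; [apply pow2_ge_0|].
      replace e with (e' * (2 * L * L + 1)) by (unfold e'; field; lra). nra. }
  unfold J in HJ.
  replace (X x0 (fst y0) + Y (snd x0) y0)%C with
   ((X x0 (fst y0) + Y (snd x0) y0 - X x0 (snd y0) - Y (fst x0) y0)
    + (X x0 (snd y0) + Y (fst x0) y0))%C by ring.
  rewrite HJ. ring.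
Qed.

(** * Primitives and Cauchy's formula *)

Lemma Cder_of_increment (F : C -> C) (z l : C) :
  (forall e, 0 < e -> exists d, 0 < d /\ forall k, Cmod k < d ->
    Cmod (F (z + k)%C - F z - k * l) <= e * Cmod k) -> Cder F z l.
Proof.
  intros H. apply Cder_eps. intros e He. destruct (H e He) as [d [Hd Hk]].
  exists d. split; [exact Hd|]. intros w Hw. specialize (Hk (w - z)%C Hw).
  replace (z + (w - z))%C with w in Hk by ring. exact Hk.
Qed.

Lemma inD_segment (z k : C) (s t : R) :
  inD z -> inD (z + k)%C -> 0 <= s <= 1 -> 0 <= t <= 1 ->
  inD (RtoC t * (z + RtoC s * k))%C.
Proof.
  unfold inD. intros Hz Hk Hs Ht. rewrite Cmod_mult, Cmod_R, Rabs_right by lra.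
  replace (z + s * k)%C with (RtoC (1 - s) * z + RtoC s * (z + k))%C
    by (rewrite RtoC_minus; ring).
  assert (Cmod (RtoC (1 - s) * z + RtoC s * (z + k)) < 1).
  { eapply Rle_lt_trans; [apply Cmod_triangle|].
    rewrite !Cmod_mult, !Cmod_R, !Rabs_right by lra.
    generalize (Cmod_ge_0 z) (Cmod_ge_0 (z + k)). intros A B.
    (* One of the weights s and 1 - s is at least 1/2, which makes the convexity inequality
       strict. *)
    destruct (Rle_dec s (1 / 2)); nra. }
  generalize (Cmod_ge_0 (RtoC (1 - s) * z + RtoC s * (z + k))). nra.
Qed.

(* Goursat for t (z + s k), whose side t = 0 degenerates to a point. *)
Lemma ray_integral_increment (h : C -> C) (z k : C) :
  analytic h -> inD z -> inD (z + k)%C ->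
  (CInt (fun t => h (RtoC t * (z + k)) * (z + k)) 0 1 =
   CInt (fun t => h (RtoC t * z) * z) 0 1
   + CInt (fun s => h (z + RtoC s * k) * k) 0 1)%C.
Proof.
  intros Hh Hz Hk.
  generalize (goursat h (fun s t => RtoC t * (z + RtoC s * k))%C
    (fun s t => RtoC t * k)%C (fun s t => z + RtoC s * k)%C (0, 1) (0, 1)
    (Cmod z + Cmod k)). simpl.
  intros G. specialize (G ltac:(lra) ltac:(lra)).
  assert (E : (CInt (fun s : R => h (0 * (z + s * k)) * (0 * k)) 0 1 +
     CInt (fun t : R => h (t * (z + 1 * k)) * (z + 1 * k)) 0 1)%C =
    (CInt (fun s : R => h (1 * (z + s * k)) * (1 * k)) 0 1 +
     CInt (fun t : R => h (t * (z + 0 * k)) * (z + 0 * k)) 0 1)%C).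
  { apply G; clear G.
    - intros s t. evar_last.
      + apply Rder_mult; [apply Rder_const|].
        apply Rder_plus; [apply Rder_const|].
        apply Rder_mult; [apply Rder_RtoC|apply Rder_const].
      + simpl. ring.
    - intros s t. evar_last.
      + apply Rder_mult; [apply Rder_RtoC|apply Rder_const].
      + simpl. ring.
    - intros s t. apply Rcont_const.
    - intros s t. apply Rcont_const.
    - intros s t Hs Ht. repeat split.
      + rewrite Cmod_mult, Cmod_R, Rabs_right by lra.
        generalize (Cmod_ge_0 z) (Cmod_ge_0 k). nra.
      + eapply Rle_trans; [apply Cmod_triangle|].
        rewrite Cmod_mult, Cmod_R, Rabs_right by lra.
        generalize (Cmod_ge_0 z) (Cmod_ge_0 k). nra.
      + apply Hh. apply inD_segment; assumption. }
  rewrite (CInt_ext (fun s : R => h (0 * (z + s * k)) * (0 * k))%C (fun _ => RtoC 0)) in E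
    by (try lra; intros; ring).
  rewrite (CInt_ext (fun t : R => h (t * (z + 1 * k)) * (z + 1 * k))%C
    (fun t : R => h (t * (z + k)) * (z + k))%C) in E
    by (try lra; intros; rewrite Cmult_1_l; reflexivity).
  rewrite (CInt_ext (fun s : R => h (1 * (z + s * k)) * (1 * k))%C
    (fun s : R => h (z + s * k) * k)%C) in E
    by (try lra; intros; rewrite !Cmult_1_l; reflexivity).
  rewrite (CInt_ext (fun t : R => h (t * (z + 0 * k)) * (z + 0 * k))%C
    (fun t : R => h (t * z) * z)%C) in E
    by (try lra; intros; rewrite Cmult_0_l, Cplus_0_r; reflexivity).
  rewrite CInt_const, Cmult_0_r, Cplus_0_l in E. rewrite E. ring.
Qed.

(** By [ray_integral_increment] the increment is the integral of h over the segment from z to z + k;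
    it differs from k h(z) by at most |k| times the oscillation of h there. [Sg g f] is this ray
    integral with h = f' g. *)
Lemma ray_integral_derive (h : C -> C) (z : C) : analytic h -> inD z ->
  Cder (fun w => CInt (fun t => h (RtoC t * w) * w)%C 0 1) z (h z).
Proof.
  intros Hh Hz. apply Cder_of_increment. intros e He.
  destruct (Hh z Hz) as [l Hl].
  destruct (Cder_continuous h z l Hl e He) as [d [Hd Hc]].
  unfold inD in Hz.
  exists (Rmin d (1 - Cmod z)). split; [apply Rmin_pos; lra|].
  intros k Hk. apply Rmin_Rgt in Hk. destruct Hk as [K1 K2].
  assert (Hzk : inD (z + k)%C).
  { unfold inD. generalize (Cmod_triangle z k). lra. }
  rewrite (ray_integral_increment h z k Hh Hz Hzk).
  replace (CInt (fun t : R => h (t * z) * z) 0 1 + CInt (fun s : R => h (z + s * k) * k) 0 1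
    - CInt (fun t : R => h (t * z) * z) 0 1 - k * h z)%C with
    (CInt (fun s : R => h (z + s * k) * k) 0 1 - RtoC (1 - 0) * (h z * k))%C
    by (replace (1 - 0) with 1 by ring; ring).
  assert (Hseg : forall t, 0 <= t <= 1 -> inD (z + RtoC t * k)%C).
  { intros t Ht. generalize (inD_segment z k t 1 Hz Hzk Ht ltac:(lra)).
    rewrite Cmult_1_l. trivial. }
  assert (C1 : forall t, 0 <= t <= 1 -> Rcont (fun s : R => (h (z + s * k) * k)%C) t).
  { intros t Ht. apply Rcont_mult; [|apply Rcont_const].
    apply (Rcont_comp h (fun s => z + RtoC s * k)%C); [apply Hh, Hseg, Ht|].
    apply Rcont_plus; [apply Rcont_const|].
    apply Rcont_mult; [apply Rcont_RtoC|apply Rcont_const]. }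
  rewrite <- CInt_const, <- CInt_minus; try lra; try exact C1;
    [|intros; apply Rcont_const].
  replace (e * Cmod k) with ((1 - 0) * (e * Cmod k)) by ring.
  apply CInt_bound; [lra| |].
  - intros t Ht. apply Rcont_minus; [apply C1, Ht|apply Rcont_const].
  - intros t Ht.
    replace (h (z + t * k) * k - h z * k)%C with ((h (z + t * k) - h z) * k)%C by ring.
    rewrite Cmod_mult. apply Rmult_le_compat_r; [apply Cmod_ge_0|]. left. apply Hc.
    replace (z + t * k - z)%C with (t * k)%C by ring.
    rewrite Cmod_mult, Cmod_R, Rabs_right by lra.
    generalize (Cmod_ge_0 k). nra.
Qed.

(** * Circles, the winding number and the Cauchy formula *)

Definition expi (t : R) : C := (cos t, sin t).

Definition circle (z0 : C) (rho : R) (t : R) : C := (z0 + RtoC rho * expi t)%C.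
Definition dcircle (rho : R) (t : R) : C := (RtoC rho * (Ci * expi t))%C.

Lemma expi_2PI : expi (2 * PI) = expi 0.
Proof. unfold expi. rewrite cos_2PI, sin_2PI, cos_0, sin_0. reflexivity. Qed.

Lemma Cmod_expi (t : R) : Cmod (expi t) = 1.
Proof.
  unfold Cmod, expi; simpl. rewrite !Rmult_1_r.
  generalize (sin2_cos2 t). unfold Rsqr. intros H. rewrite Rplus_comm, H. apply sqrt_1.
Qed.

Lemma Rder_expi (t : R) : Rder expi t (Ci * expi t)%C.
Proof. apply Rder_pair; simpl; auto_derive; auto; ring. Qed.

Lemma Rcont_expi (t : R) : Rcont expi t.
Proof. apply Rder_continuous with (Ci * expi t)%C. apply Rder_expi. Qed.

Lemma Rder_circle (z0 : C) (rho t : R) : Rder (circle z0 rho) t (dcircle rho t).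
Proof.
  evar_last.
  - apply Rder_plus; [apply Rder_const|].
    apply Rder_mult; [apply Rder_const|apply Rder_expi].
  - unfold dcircle; simpl. ring.
Qed.

Lemma Rcont_circle (z0 : C) (rho t : R) : Rcont (circle z0 rho) t.
Proof. apply Rder_continuous with (dcircle rho t). apply Rder_circle. Qed.

Lemma Rcont_dcircle (rho t : R) : Rcont (dcircle rho) t.
Proof.
  unfold dcircle. apply (Rcont_mult (fun _ => RtoC rho)); [apply Rcont_const|].
  apply (Rcont_mult (fun _ => Ci)); [apply Rcont_const|apply Rcont_expi].
Qed.

Lemma Cmod_dcircle (rho t : R) : 0 <= rho -> Cmod (dcircle rho t) = rho.
Proof.
  intros H. unfold dcircle. rewrite !Cmod_mult, Cmod_expi, Cmod_Ci, Cmod_R, Rabs_right; lra.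
Qed.

Lemma Cmod_circle_center (z0 : C) (rho t : R) : 0 <= rho ->
  Cmod (circle z0 rho t - z0) = rho.
Proof.
  intros H. unfold circle. replace (z0 + rho * expi t - z0)%C with (rho * expi t)%C by ring.
  rewrite Cmod_mult, Cmod_expi, Cmod_R, Rabs_right; lra.
Qed.

Lemma circle_closed (z0 : C) (rho : R) : circle z0 rho (2 * PI) = circle z0 rho 0.
Proof. unfold circle. rewrite expi_2PI. reflexivity. Qed.

Lemma Cmod_circle_sub (z0 z : C) (rho t : R) : 0 <= rho ->
  rho - Cmod (z - z0) <= Cmod (circle z0 rho t - z) <= rho + Cmod (z - z0).
Proof.
  intros H. generalize (Cmod_circle_center z0 rho t H). intros E.
  replace (circle z0 rho t - z)%C with ((circle z0 rho t - z0) - (z - z0))%C by ring.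
  generalize (Cmod_triangle_inv (circle z0 rho t - z0) (z - z0))
    (Cmod_triangle_sub (circle z0 rho t - z0) (z - z0)). lra.
Qed.

(* Translating the centre to the pole keeps the integral of du/u, and the
   centred circle gives the constant integrand i. *)
Lemma winding_number (z0 z : C) (rho : R) : Cmod (z - z0) < rho ->
  CInt (fun t => / (circle z0 rho t - z) * dcircle rho t)%C 0 (2 * PI)
  = (RtoC (2 * PI) * Ci)%C.
Proof.
  intros Hz. generalize (Cmod_ge_0 (z - z0)) PI_RGT_0. intros Hz0 Hpi.
  assert (Hne : forall s t, 0 <= s <= 1 ->
    (circle z0 rho t - (z0 + RtoC s * (z - z0)))%C <> 0%C).
  { intros s t Hs. apply Cmod_gt_0.
    generalize (Cmod_circle_sub z0 (z0 + RtoC s * (z - z0)) rho t ltac:(lra)).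
    replace (z0 + s * (z - z0) - z0)%C with (s * (z - z0))%C by ring.
    rewrite Cmod_mult, Cmod_R, Rabs_right by lra. nra. }
  assert (G := goursat (fun u => / u)%C
    (fun s t => circle z0 rho t - (z0 + RtoC s * (z - z0)))%C
    (fun s t => - (z - z0))%C (fun s t => dcircle rho t) (0, 1) (0, 2 * PI)
    (rho + Cmod (z - z0))). simpl in G.
  (* The sides t = 0 and t = 2 pi now carry the same integral, which [Cplus_cancel_l] removes,
     leaving the equality of the sides s = 0 and s = 1. *)
  rewrite circle_closed in G.
  specialize (G ltac:(lra) ltac:(lra)).
  rewrite (CInt_ext (fun t => / (circle z0 rho t - z) * dcircle rho t)%C
    (fun t => / (circle z0 rho t - (z0 + RtoC 1 * (z - z0))) * dcircle rho t)%C);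
    [|lra|intros t _; do 3 f_equal; ring].
  assert (E : CInt (fun t => / (circle z0 rho t - (z0 + RtoC 0 * (z - z0))) * dcircle rho t)%C
     0 (2 * PI) = (RtoC (2 * PI) * Ci)%C).
  { rewrite (CInt_ext _ (fun _ => Ci)); [|lra|].
    - rewrite CInt_const. rewrite Rminus_0_r. reflexivity.
    - intros t _.
      replace (circle z0 rho t - (z0 + 0 * (z - z0)))%C with (rho * expi t)%C
        by (unfold circle; ring).
      unfold dcircle. assert (A : RtoC rho <> 0%C).
      { apply Cmod_gt_0. rewrite Cmod_R, Rabs_right; lra. }
      assert (B : expi t <> 0%C) by (apply Cmod_gt_0; rewrite Cmod_expi; lra).
      field. auto. }
  rewrite <- E.
  eapply Cplus_cancel_l. apply G; clear G.
  - intros s t. evar_last.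
    + apply Rder_minus; [apply Rder_const|].
      apply Rder_plus; [apply Rder_const|].
      apply Rder_mult; [apply Rder_RtoC|apply Rder_const].
    + simpl. ring.
  - intros s t. evar_last.
    + apply Rder_minus; [apply Rder_circle|apply Rder_const].
    + simpl. ring.
  - intros s t. apply Rcont_const.
  - intros s t. apply Rcont_dcircle.
  - intros s t Hs Ht. rewrite Cmod_opp, Cmod_dcircle by lra. repeat split; try lra.
    eexists. apply Cder_inv. apply Hne. exact Hs.
Qed.

Lemma Cder_quotient_slope (f : C -> C) (z w : C) : w <> z ->
  ex_Cder f w ->
  ex_Cder (fun u => (f u - f z) * / (u - z))%C w.
Proof.
  intros Hne [l Hl].
  assert (Hz : (w - z)%C <> 0%C) by (intros E; apply Hne, Cminus_eq_0, E).
  eexists. apply Cder_mult.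
  - apply Cder_minus; [exact Hl|apply Cder_const].
  - apply (Cder_inv_comp (fun u => u - z)%C); [exact Hz|].
    apply Cder_minus; [apply Cder_id|apply Cder_const].
Qed.

(** The slope q is differentiable only off z, so the circle is contracted towards z without reaching
    it: I s is constant for 0 < s <= 1. Near z the slope is bounded by |f'(z)| + 1 while the
    contracted curve has length proportional to s, so this constant is 0; the singularity never has
    to be removed. *)
Lemma Cauchy_slope (f : C -> C) (z0 z : C) (rho : R) : Cmod (z - z0) < rho ->
  (forall w, Cmod (w - z0) <= rho ->
     ex_Cder f w) ->
  CInt (fun t => (f (circle z0 rho t) - f z) * / (circle z0 rho t - z) * dcircle rho t)%C
    0 (2 * PI) = 0%C.
Proof.
  intros Hz Hf. generalize (Cmod_ge_0 (z - z0)) PI_RGT_0. intros Hz0 Hpi.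
  set (q := fun u => ((f u - f z) * / (u - z))%C).
  set (gam := circle z0 rho).
  set (I := fun s => CInt (fun t => q (z + RtoC s * (gam t - z)) * (RtoC s * dcircle rho t))%C
    0 (2 * PI)).
  assert (Hgz : forall t, gam t <> z).
  { intros t E. generalize (Cmod_circle_sub z0 z rho t ltac:(lra)). fold gam.
    rewrite E. replace (z - z)%C with (RtoC 0) by ring. rewrite Cmod_0. lra. }
  assert (Hq : forall s t, 0 < s <= 1 ->
    ex_Cder q (z + RtoC s * (gam t - z))%C).
  { intros s t Hs. apply Cder_quotient_slope.
    - intros E. apply (Hgz t).
      assert (K : (RtoC s * (gam t - z))%C = 0%C).
      { replace (s * (gam t - z))%C with ((z + s * (gam t - z)) - z)%C by ring.
        rewrite E. ring. }
      apply (f_equal Cmod) in K. rewrite Cmod_mult, Cmod_R, Cmod_0, Rabs_right in K by lra.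
      assert (K' : Cmod (gam t - z) = 0).
      { apply Rmult_integral in K. destruct K; lra. }
      apply Cminus_eq_0, Cmod_eq_0, K'.
    - apply Hf.
      replace (z + s * (gam t - z) - z0)%C with
        (RtoC (1 - s) * (z - z0) + s * (gam t - z0))%C by (rewrite RtoC_minus; ring).
      eapply Rle_trans; [apply Cmod_triangle|].
      rewrite !Cmod_mult, !Cmod_R, !Rabs_right by lra.
      unfold gam. rewrite Cmod_circle_center by lra. nra. }
  assert (Hconst : forall s, 0 < s < 1 -> I 1 = I s).
  { intros s0 Hs0.
    assert (G := goursat q (fun s t => z + RtoC s * (gam t - z))%C
      (fun s t => gam t - z)%C (fun s t => RtoC s * dcircle rho t)%C (s0, 1) (0, 2 * PI)
      (2 * rho)). simpl in G.
    unfold gam in G. rewrite circle_closed in G. fold gam in G.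
    specialize (G ltac:(lra) ltac:(lra)).
    eapply Cplus_cancel_l. apply G; clear G.
    - intros s t. evar_last.
      + apply Rder_plus; [apply Rder_const|].
        apply Rder_mult; [apply Rder_RtoC|apply Rder_const].
      + simpl. ring.
    - intros s t. evar_last.
      + apply Rder_plus; [apply Rder_const|].
        apply Rder_mult; [apply Rder_const|].
        apply Rder_minus; [apply Rder_circle|apply Rder_const].
      + simpl. ring.
    - intros s t. apply Rcont_const.
    - intros s t. apply Rcont_mult; [apply Rcont_const|apply Rcont_dcircle].
    - intros s t Hs Ht. repeat split.
      + generalize (Cmod_circle_sub z0 z rho t ltac:(lra)). fold gam. lra.
      + rewrite Cmod_mult, Cmod_dcircle, Cmod_R, Rabs_right by lra. nra.
      + apply Hq. lra. }
  assert (E1 : CInt (fun t => (f (gam t) - f z) * / (gam t - z) * dcircle rho t)%C 0 (2 * PI)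
    = I 1).
  { unfold I. apply CInt_ext; [lra|]. intros t _.
    replace (z + 1 * (gam t - z))%C with (gam t) by ring. unfold q. ring. }
  change (CInt (fun t => (f (gam t) - f z) * / (gam t - z) * dcircle rho t)%C 0 (2 * PI)
    = 0%C). rewrite E1.
  destruct (Hf z ltac:(lra)) as [l Hl].
  destruct (Cder_lipschitz f z l Hl) as [d [Hd HB]].
  set (B := Cmod l + 1) in *.
  assert (HB0 : 0 < B) by (generalize (Cmod_ge_0 l); unfold B; lra).
  assert (Hsmall : forall s, 0 < s < 1 -> s * (2 * rho) < d ->
    Cmod (I 1) <= (2 * PI - 0) * (B * (s * rho))).
  { intros s Hs Hsd. rewrite (Hconst s Hs). unfold I. apply CInt_bound; [lra| |].
    - intros t Ht. apply Rcont_mult.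
      + apply (Rcont_comp q (fun t => z + RtoC s * (gam t - z))%C); [apply Hq; lra|].
        apply Rcont_plus; [apply Rcont_const|].
        apply Rcont_mult; [apply Rcont_const|].
        apply Rcont_minus; [apply Rcont_circle|apply Rcont_const].
      + apply Rcont_mult; [apply Rcont_const|apply Rcont_dcircle].
    - intros t Ht.
      rewrite !Cmod_mult, Cmod_dcircle, Cmod_R, Rabs_right by lra.
      apply Rmult_le_compat_r; [nra|].
      unfold q. set (w := (z + s * (gam t - z))%C).
      assert (Ew : (w - z)%C = (s * (gam t - z))%C) by (unfold w; ring).
      assert (Hg : 0 < Cmod (gam t - z) <= 2 * rho).
      { generalize (Cmod_circle_sub z0 z rho t ltac:(lra)). fold gam. lra. }
      assert (Hw : Cmod (w - z) = s * Cmod (gam t - z)).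
      { rewrite Ew, Cmod_mult, Cmod_R, Rabs_right; lra. }
      assert (Hw0 : 0 < Cmod (w - z)) by (rewrite Hw; apply Rmult_lt_0_compat; lra).
      rewrite Cmod_mult, Cmod_inv by (apply Cmod_gt_0; exact Hw0).
      apply Rmult_le_reg_r with (1 := Hw0). rewrite Rmult_assoc, Rinv_l by lra.
      rewrite Rmult_1_r. apply HB. rewrite Hw. nra. }
  apply Cmod_eq_0. apply Rle_antisym; [|apply Cmod_ge_0].
  apply Rnot_lt_le. intros Hpos.
  assert (Hrho : 0 < rho) by lra.
  (* M is twice the constant in [Hsmall], so the last entry of the minimum below yields |I 1| <= |I
     1| / 2. The entry d / (4 rho) keeps the contracted curve within d of z. *)
  set (M := 4 * PI * B * rho).
  assert (HM : 0 < M) by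
    (unfold M; apply Rmult_lt_0_compat; [apply Rmult_lt_0_compat|]; lra).
  set (s := Rmin (1 / 2) (Rmin (d / (4 * rho)) (Cmod (I 1) / M))).
  assert (A1 : 0 < d / (4 * rho)) by (apply Rdiv_lt_0_compat; lra).
  assert (A2 : 0 < Cmod (I 1) / M) by (apply Rdiv_lt_0_compat; lra).
  assert (S0 : 0 < s) by (repeat apply Rmin_pos; lra).
  assert (S1 : s <= 1 / 2) by apply Rmin_l.
  assert (S2 : s <= d / (4 * rho)) by (eapply Rle_trans; [apply Rmin_r|apply Rmin_l]).
  assert (S3 : s <= Cmod (I 1) / M) by (eapply Rle_trans; [apply Rmin_r|apply Rmin_r]).
  apply Rmult_le_compat_r with (r := 4 * rho) in S2; [|lra].
  replace (d / (4 * rho) * (4 * rho)) with d in S2 by (field; lra).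
  apply Rmult_le_compat_r with (r := M) in S3; [|lra].
  replace (Cmod (I 1) / M * M) with (Cmod (I 1)) in S3 by (field; lra).
  generalize (Hsmall s ltac:(lra) ltac:(lra)).
  replace ((2 * PI - 0) * (B * (s * rho))) with (s * M / 2) by (unfold M; field). lra.
Qed.

(** Write f on the circle as its difference from f(z) plus f(z): the first part integrates to 0 by
    [Cauchy_slope], the second to f(z) times the winding integral. *)
Lemma Cauchy_formula (f : C -> C) (z0 z : C) (rho : R) : Cmod (z - z0) < rho ->
  (forall w, Cmod (w - z0) <= rho ->
     ex_Cder f w) ->
  CInt (fun t => f (circle z0 rho t) * dcircle rho t * / (circle z0 rho t - z))%C 0 (2 * PI)
  = (RtoC (2 * PI) * Ci * f z)%C.
Proof.
  intros Hz Hf. generalize (Cmod_ge_0 (z - z0)) PI_RGT_0. intros Hz0 Hpi.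
  generalize (Cauchy_slope f z0 z rho Hz Hf).
  assert (Hi : forall t, ex_Cder
    (fun u => / u)%C (circle z0 rho t - z)%C).
  { intros t. eexists. apply Cder_inv. apply Cmod_gt_0.
    generalize (Cmod_circle_sub z0 z rho t ltac:(lra)). lra. }
  assert (Ci' : forall t, Rcont (fun t => / (circle z0 rho t - z))%C t).
  { intros t. apply (Rcont_comp (fun u => / u)%C (fun t => circle z0 rho t - z)%C);
    [apply Hi|]. apply Rcont_minus; [apply Rcont_circle|apply Rcont_const]. }
  assert (Cf : forall t, Rcont (fun t => f (circle z0 rho t))%C t).
  { intros t. apply (Rcont_comp f (circle z0 rho)); [|apply Rcont_circle].
    apply Hf. rewrite Cmod_circle_center; lra. }
  intros H. rewrite <- (winding_number z0 z rho Hz), Cmult_comm.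
  rewrite <- CInt_mult_l; [|lra|].
  2:{ intros t _. apply Rcont_mult; [apply Ci'|apply Rcont_dcircle]. }
  apply Cminus_eq_0. rewrite <- CInt_minus; [|lra| |].
  - rewrite <- H. apply CInt_ext; [lra|]. intros t _. ring.
  - intros t _. apply Rcont_mult; [|apply Ci'].
    apply Rcont_mult; [apply Cf|apply Rcont_dcircle].
  - intros t _. apply Rcont_mult; [apply Rcont_const|].
    apply Rcont_mult; [apply Ci'|apply Rcont_dcircle].
Qed.

(** * Derivatives of analytic functions *)

(** Differentiation under the integral sign: the remainder of the kernel is quadratic in h uniformly
    in t, because gam keeps the distance r from z. As w enters through gam t - w, k' stands for
    minus the derivative of k. The kernel is left general to serve both 1/u, which yields f', and
    1/u^2, which differentiates f' again. *)
Lemma Cder_kernel_integral (phi gam : R -> C) (k k' : C -> C) (a b : R) (z : C) (r B : R) :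
  a <= b -> 0 < r -> 0 <= B ->
  (forall t, a <= t <= b -> Rcont phi t) ->
  (forall t, a <= t <= b -> Rcont gam t) ->
  (forall t, a <= t <= b -> r <= Cmod (gam t - z)) ->
  (forall u, 0 < Cmod u -> ex_Cder k u /\ ex_Cder k' u) ->
  (forall u h, r <= Cmod u -> Cmod h <= r / 2 ->
     Cmod (k (u - h)%C - k u - h * k' u) <= B * Cmod h ^ 2) ->
  Cder (fun w => CInt (fun t => phi t * k (gam t - w))%C a b) z
    (CInt (fun t => phi t * k' (gam t - z))%C a b).
Proof.
  intros Hab Hr HB Cphi Cgam Hgam Hk HkB.
  destruct (bounded_continuity (V := C_R_NormedModule) phi a b) as [M HM].
  { exact Cphi. }
  assert (HM0 : forall t, a <= t <= b -> Cmod (phi t) <= Rabs M).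
  { intros t Ht. rewrite Cmod_norm. left. apply Rlt_le_trans with (1 := HM t Ht).
    apply Rle_abs. }
  generalize (Rabs_pos M). intros HMp.
  set (W := (b - a) * (Rabs M * B) + 1).
  assert (HW0 : 0 <= (b - a) * (Rabs M * B)).
  { apply Rmult_le_pos; [lra|]. apply Rmult_le_pos; assumption. }
  apply Cder_of_increment. intros e He.
  assert (HW : 0 < W) by (unfold W; lra).
  assert (HeW : 0 < e / W) by (apply Rdiv_lt_0_compat; assumption).
  exists (Rmin (r / 2) (e / W)). split; [apply Rmin_pos; lra|].
  intros h Hh. apply Rmin_Rgt in Hh. destruct Hh as [H1 H2].
  assert (Cg : forall w t, a <= t <= b -> Rcont (fun s => gam s - w)%C t).
  { intros w t Ht. apply Rcont_minus; [apply Cgam, Ht|apply Rcont_const]. }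
  assert (C1 : forall t, a <= t <= b -> Rcont (fun s => phi s * k (gam s - (z + h)))%C t).
  { intros t Ht. apply Rcont_mult; [apply Cphi, Ht|].
    apply (Rcont_comp k (fun s => gam s - (z + h))%C); [|apply Cg, Ht].
    apply Hk. generalize (Cmod_triangle_inv (gam t - z) h) (Hgam t Ht).
    replace (gam t - z - h)%C with (gam t - (z + h))%C by ring. lra. }
  assert (C2 : forall t, a <= t <= b -> Rcont (fun s => phi s * k (gam s - z))%C t).
  { intros t Ht. apply Rcont_mult; [apply Cphi, Ht|].
    apply (Rcont_comp k (fun s => gam s - z)%C); [|apply Cg, Ht].
    apply Hk. generalize (Hgam t Ht). lra. }
  assert (C3 : forall t, a <= t <= b -> Rcont (fun s => phi s * k' (gam s - z))%C t).
  { intros t Ht. apply Rcont_mult; [apply Cphi, Ht|].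
    apply (Rcont_comp k' (fun s => gam s - z)%C); [|apply Cg, Ht].
    apply Hk. generalize (Hgam t Ht). lra. }
  rewrite <- CInt_mult_l; [|exact Hab|exact C3].
  rewrite <- CInt_minus; [|exact Hab|exact C1|exact C2].
  assert (C4 : forall t, a <= t <= b -> Rcont (fun s => h * (phi s * k' (gam s - z)))%C t).
  { intros t Ht. apply Rcont_mult; [apply Rcont_const|apply C3, Ht]. }
  assert (C5 : forall t, a <= t <= b ->
    Rcont (fun s => phi s * k (gam s - (z + h)) - phi s * k (gam s - z))%C t).
  { intros t Ht. apply Rcont_minus; [apply C1|apply C2]; exact Ht. }
  rewrite <- CInt_minus; [|exact Hab|exact C5|exact C4].
  apply Rle_trans with ((b - a) * (Rabs M * (B * Cmod h ^ 2))).
  - apply (CInt_bound _ a b); [exact Hab| |].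
    + intros t Ht. apply Rcont_minus; [apply C5|apply C4]; exact Ht.
    + intros t Ht.
      replace (phi t * k (gam t - (z + h)) - phi t * k (gam t - z)
        - h * (phi t * k' (gam t - z)))%C with
        (phi t * (k (gam t - z - h) - k (gam t - z) - h * k' (gam t - z)))%C
        by (replace (gam t - z - h)%C with (gam t - (z + h))%C by ring; ring).
      rewrite Cmod_mult. apply Rmult_le_compat; try apply Cmod_ge_0; [apply HM0, Ht|].
      apply HkB; [apply Hgam, Ht|lra].
  - apply Rmult_lt_compat_r with (r := W) in H2; [|exact HW].
    replace (e / W * W) with e in H2 by (field; lra).
    replace ((b - a) * (Rabs M * (B * Cmod h ^ 2))) with
      ((b - a) * (Rabs M * B) * Cmod h * Cmod h) by ring.
    generalize (Cmod_ge_0 h). intros Hh0.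
    apply Rmult_le_compat_r; [exact Hh0|].
    replace ((b - a) * (Rabs M * B)) with (W - 1) by (unfold W; ring). lra.
Qed.

Lemma inv_kernel_expansion (r : R) (u h : C) : 0 < r -> r <= Cmod u -> Cmod h <= r / 2 ->
  Cmod (/ (u - h) - / u - h * (/ u * / u)) <= 2 / r ^ 3 * Cmod h ^ 2.
Proof.
  intros Hr Hu Hh.
  assert (Huh : r / 2 <= Cmod (u - h)) by (generalize (Cmod_triangle_inv u h); lra).
  assert (N1 : u <> 0%C) by (apply Cmod_gt_0; lra).
  assert (N2 : (u - h)%C <> 0%C) by (apply Cmod_gt_0; lra).
  replace (/ (u - h) - / u - h * (/ u * / u))%C with
    (h * h * (/ u * / u * / (u - h)))%C by (field; auto).
  rewrite !Cmod_mult, !Cmod_inv by assumption.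
  rewrite Rmult_comm. replace (Cmod h ^ 2) with (Cmod h * Cmod h) by ring.
  apply Rmult_le_compat_r; [apply Rle_0_sqr|].
  replace (2 / r ^ 3) with (/ r * / r * / (r / 2)) by (field; lra).
  assert (I1 : 0 < / Cmod u <= / r).
  { split; [apply Rinv_0_lt_compat; lra|apply Rinv_le_contravar; lra]. }
  assert (I2 : 0 < / Cmod (u - h) <= / (r / 2)).
  { split; [apply Rinv_0_lt_compat; lra|apply Rinv_le_contravar; lra]. }
  apply Rmult_le_compat; [|lra| |lra].
  - apply Rmult_le_pos; lra.
  - apply Rmult_le_compat; lra.
Qed.

Lemma inv2_kernel_expansion (r : R) (u h : C) : 0 < r -> r <= Cmod u -> Cmod h <= r / 2 ->
  Cmod (/ (u - h) * / (u - h) - / u * / u - h * (2 * (/ u * / u * / u)))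
    <= 16 / r ^ 4 * Cmod h ^ 2.
Proof.
  intros Hr Hu Hh.
  assert (Huh : r / 2 <= Cmod (u - h)) by (generalize (Cmod_triangle_inv u h); lra).
  assert (N1 : u <> 0%C) by (apply Cmod_gt_0; lra).
  assert (N2 : (u - h)%C <> 0%C) by (apply Cmod_gt_0; lra).
  replace (/ (u - h) * / (u - h) - / u * / u - h * (2 * (/ u * / u * / u)))%C with
    (h * h * ((3 * u - 2 * h) * / u * (/ u * / u * (/ (u - h) * / (u - h)))))%C
    by (field; auto).
  assert (I1 : 0 < / Cmod u <= / r).
  { split; [apply Rinv_0_lt_compat; lra|apply Rinv_le_contravar; lra]. }
  assert (I2 : 0 < / Cmod (u - h) <= / (r / 2)).
  { split; [apply Rinv_0_lt_compat; lra|apply Rinv_le_contravar; lra]. }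
  (* Here 2 |h| <= r <= |u|, so |3u - 2h| <= 4 |u|; the other four inverses contribute r^-2 and
     (r/2)^-2, whence 16 / r^4. *)
  assert (I3 : Cmod ((3 * u - 2 * h) * / u) <= 4).
  { rewrite Cmod_mult, Cmod_inv by assumption.
    apply Rmult_le_reg_r with (Cmod u); [lra|]. rewrite Rmult_assoc, Rinv_l by lra.
    rewrite Rmult_1_r. eapply Rle_trans; [apply Cmod_triangle_sub|].
    rewrite !Cmod_mult, !Cmod_R, !Rabs_right by lra. lra. }
  rewrite Cmod_mult, (Rmult_comm (Cmod (h * h))), (Cmod_mult h h).
  replace (Cmod h ^ 2) with (Cmod h * Cmod h) by ring.
  apply Rmult_le_compat_r; [apply Rle_0_sqr|].
  replace (16 / r ^ 4) with (4 * (/ r * / r * (/ (r / 2) * / (r / 2)))) by (field; lra).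
  rewrite Cmod_mult. apply Rmult_le_compat; try apply Cmod_ge_0; [exact I3|].
  rewrite !Cmod_mult, !Cmod_inv by assumption.
  apply Rmult_le_compat.
  - apply Rmult_le_pos; lra.
  - apply Rmult_le_pos; lra.
  - apply Rmult_le_compat; lra.
  - apply Rmult_le_compat; lra.
Qed.

Lemma Rcont_circle_data (f : C -> C) (z0 : C) (rho t : R) : 0 <= rho ->
  (forall w, Cmod (w - z0) <= rho -> ex_Cder f w) ->
  Rcont (fun s => f (circle z0 rho s) * dcircle rho s)%C t.
Proof.
  intros Hr Hf. apply Rcont_mult; [|apply Rcont_dcircle].
  apply (Rcont_comp f (circle z0 rho)); [|apply Rcont_circle].
  apply Hf. rewrite Cmod_circle_center; lra.
Qed.

Lemma two_PI_Ci_neq_0 : (RtoC (2 * PI) * Ci)%C <> 0%C.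
Proof.
  apply Cmod_gt_0. generalize PI_RGT_0. intros H.
  rewrite Cmod_mult, Cmod_Ci, Cmod_R, Rabs_right; lra.
Qed.

(** Both sides of the Cauchy formula agree near z and are differentiated there. The centre z0 is
    kept apart from z so that one fixed circle represents f' at all nearby points, ready to be
    differentiated once more. *)
Lemma Cauchy_derivative (f : C -> C) (z0 z : C) (rho : R) : Cmod (z - z0) < rho ->
  (forall w, Cmod (w - z0) <= rho -> ex_Cder f w) ->
  cderiv f z = (/ (RtoC (2 * PI) * Ci) *
    CInt (fun t => f (circle z0 rho t) * dcircle rho t *
      (/ (circle z0 rho t - z) * / (circle z0 rho t - z))) 0 (2 * PI))%C.
Proof.
  intros Hz Hf. generalize (Cmod_ge_0 (z - z0)) PI_RGT_0 two_PI_Ci_neq_0.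
  intros Hz0 Hpi Hc. set (c := (RtoC (2 * PI) * Ci)%C) in *.
  set (r := rho - Cmod (z - z0)).
  assert (Hr : 0 < r) by (unfold r; lra).
  set (phi := fun t => (f (circle z0 rho t) * dcircle rho t)%C).
  set (D := CInt (fun t => phi t * (/ (circle z0 rho t - z) * / (circle z0 rho t - z)))%C
    0 (2 * PI)).
  change (cderiv f z = (/ c * D)%C).
  assert (HD : Cder (fun w => CInt (fun t => phi t * / (circle z0 rho t - w))%C 0 (2 * PI)) z D).
  { apply (Cder_kernel_integral phi (circle z0 rho) (fun u => / u)%C (fun u => / u * / u)%C
      0 (2 * PI) z r (2 / r ^ 3)).
    - lra.
    - exact Hr.
    - left. apply Rdiv_lt_0_compat; [lra|apply pow_lt, Hr].
    - intros t _. apply Rcont_circle_data; [lra|exact Hf].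
    - intros t _. apply Rcont_circle.
    - intros t _. unfold r. apply Cmod_circle_sub. lra.
    - intros u Hu. apply Cmod_gt_0 in Hu. split; eexists.
      + apply Cder_inv, Hu.
      + apply Cder_mult; apply Cder_inv, Hu.
    - intros u h Hu Hh. apply inv_kernel_expansion; assumption. }
  assert (HE : Cder (fun w => c * f w)%C z D).
  { apply (Cder_ext (fun w => CInt (fun t => phi t * / (circle z0 rho t - w))%C 0 (2 * PI))
      _ z D r Hr); [|exact HD].
    intros w Hw. unfold phi, c. apply Cauchy_formula; [|exact Hf].
    unfold r in Hw. replace (w - z0)%C with ((w - z) + (z - z0))%C by ring.
    generalize (Cmod_triangle (w - z) (z - z0)). lra. }
  assert (HF : Cder (fun w => c * f w)%C z (0 * f z + c * cderiv f z)%C).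
  { apply (Cder_mult (fun _ => c)); [apply Cder_const|].
    apply cderiv_correct, Hf. lra. }
  rewrite (Cder_unique _ _ _ _ HE HF). field. exact Hc.
Qed.

Lemma Cauchy_estimate (f : C -> C) (z : C) (rho M : R) : 0 < rho ->
  (forall w, Cmod (w - z) <= rho -> ex_Cder f w) ->
  (forall w, Cmod (w - z) = rho -> Cmod (f w) <= M) ->
  Cmod (cderiv f z) <= M / rho.
Proof.
  intros Hr Hf HM. generalize PI_RGT_0. intros Hpi.
  assert (Hzz : Cmod (z - z) = 0) by (replace (z - z)%C with (RtoC 0) by ring; apply Cmod_0).
  rewrite (Cauchy_derivative f z z rho) by (try exact Hf; lra).
  rewrite Cmod_mult, Cmod_inv by exact two_PI_Ci_neq_0.
  rewrite Cmod_mult, Cmod_Ci, Cmod_R, Rabs_right, Rmult_1_r by lra.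
  apply Rmult_le_reg_l with (2 * PI); [lra|].
  rewrite <- Rmult_assoc, Rinv_r, Rmult_1_l by lra.
  replace (2 * PI * (M / rho)) with ((2 * PI - 0) * (M / rho)) by ring.
  apply (CInt_bound _ 0 (2 * PI)); [lra| |].
  - intros t _. apply Rcont_mult; [apply Rcont_circle_data; [lra|exact Hf]|].
    assert (K : Rcont (fun s => / (circle z rho s - z))%C t).
    { apply (Rcont_comp (fun u => / u)%C (fun s => circle z rho s - z)%C).
      - eexists. apply Cder_inv, Cmod_gt_0. rewrite Cmod_circle_center; lra.
      - apply Rcont_minus; [apply Rcont_circle|apply Rcont_const]. }
    apply Rcont_mult; exact K.
  - intros t _.
    assert (N : (circle z rho t - z)%C <> 0%C).
    { apply Cmod_gt_0. rewrite Cmod_circle_center; lra. }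
    rewrite !Cmod_mult, !Cmod_inv, Cmod_circle_center, Cmod_dcircle by (try exact N; lra).
    replace (Cmod (f (circle z rho t)) * rho * (/ rho * / rho)) with
      (Cmod (f (circle z rho t)) / rho) by (field; lra).
    apply Rmult_le_compat_r; [left; apply Rinv_0_lt_compat; exact Hr|].
    apply HM. apply Cmod_circle_center. lra.
Qed.

Lemma inD_closed_disk (z w : C) (rho : R) : rho < 1 - Cmod z -> Cmod (w - z) <= rho -> inD w.
Proof.
  intros Hr Hw. unfold inD. replace w with ((w - z) + z)%C by ring.
  generalize (Cmod_triangle (w - z) z). lra.
Qed.

(** Near z, f' is an integral over one circle with kernel 1/u^2, again covered by
    [Cder_kernel_integral]. This makes f' g analytic, so that [Sg] is a primitive of it. *)
Lemma analytic_cderiv (f : C -> C) : analytic f -> analytic (cderiv f).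
Proof.
  intros Hf z Hz. unfold inD in Hz. generalize PI_RGT_0. intros Hpi.
  set (rho := (1 - Cmod z) / 2).
  assert (Hr : 0 < rho) by (unfold rho; lra).
  assert (Hdisk : forall w, Cmod (w - z) <= rho -> ex_Cder f w).
  { intros w Hw. apply Hf. apply (inD_closed_disk z w rho); [unfold rho; lra|exact Hw]. }
  eexists. apply (Cder_ext (fun w => / (RtoC (2 * PI) * Ci) *
    CInt (fun t => f (circle z rho t) * dcircle rho t *
      (/ (circle z rho t - w) * / (circle z rho t - w))) 0 (2 * PI))%C _ z _ rho Hr).
  { intros w Hw. symmetry. apply Cauchy_derivative; assumption. }
  apply (Cder_mult (fun _ => / (RtoC (2 * PI) * Ci))%C); [apply Cder_const|].
  apply (Cder_kernel_integral (fun t => f (circle z rho t) * dcircle rho t)%C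
    (circle z rho) (fun u => / u * / u)%C (fun u => 2 * (/ u * / u * / u))%C
    0 (2 * PI) z rho (16 / rho ^ 4)).
  - lra.
  - exact Hr.
  - left. apply Rdiv_lt_0_compat; [lra|apply pow_lt, Hr].
  - intros t _. apply Rcont_circle_data; [lra|exact Hdisk].
  - intros t _. apply Rcont_circle.
  - intros t _. rewrite Cmod_circle_center; lra.
  - intros u Hu. apply Cmod_gt_0 in Hu. split; eexists.
    + apply Cder_mult; apply Cder_inv, Hu.
    + apply (Cder_mult (fun _ => RtoC 2)); [apply Cder_const|].
      apply (Cder_mult (fun v => / v * / v)%C); [|apply Cder_inv, Hu].
      apply Cder_mult; apply Cder_inv, Hu.
  - intros u h Hu Hh. apply inv2_kernel_expansion; assumption.
Qed.

Lemma Sg_derive (g f : C -> C) (z : C) : analytic g -> analytic f -> inD z ->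
  Cder (Sg g f) z (cderiv f z * g z)%C.
Proof.
  intros Hg Hf Hz.
  apply (ray_integral_derive (fun w => cderiv f w * g w)%C z); [|exact Hz].
  intros w Hw. destruct (analytic_cderiv f Hf w Hw) as [l Hl].
  destruct (Hg w Hw) as [m Hm]. eexists. apply Cder_mult; eassumption.
Qed.

Lemma cderiv_Sg (g f : C -> C) (z : C) : analytic g -> analytic f -> inD z ->
  cderiv (Sg g f) z = (cderiv f z * g z)%C.
Proof. intros Hg Hf Hz. apply cderiv_unique, Sg_derive; assumption. Qed.

Lemma analytic_Sg (g f : C -> C) : analytic g -> analytic f -> analytic (Sg g f).
Proof. intros Hg Hf z Hz. eexists. apply Sg_derive; assumption. Qed.

Lemma Sg_0 (g f : C -> C) : Sg g f 0 = 0%C.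
Proof.
  change (CInt (fun t => cderiv f (RtoC t * 0) * g (RtoC t * 0) * 0)%C 0 1 = 0%C).
  rewrite (CInt_ext _ (fun _ => RtoC 0)) by (try lra; intros; ring).
  rewrite CInt_const. ring.
Qed.

(** * Weighted estimates *)

Lemma one_minus_sq_pos (r : R) : 0 <= r < 1 -> 0 < 1 - r ^ 2.
Proof. intros H. nra. Qed.

Lemma Cmod_inD (z : C) : inD z -> 0 <= Cmod z < 1.
Proof. intros H. split; [apply Cmod_ge_0|exact H]. Qed.

Lemma Rpower_pos (x y : R) : 0 < Rpower x y.
Proof. apply exp_pos. Qed.

(** For s = (1 + r)/2 one has 1 - r^2 <= 2 (1 - s^2), so the power in (U) changes by at most
    2^alpha. *)
Lemma property_U_midpoint (nu : R -> R) : weight nu -> property_U nu ->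
  exists K, 0 < K /\ forall r, 0 <= r < 1 -> nu r <= K * nu ((1 + r) / 2).
Proof.
  intros [W1 _] [alpha [Ha [C0 [HC H]]]].
  generalize (Rpower_pos 2 alpha). intros H2.
  exists (C0 * Rpower 2 alpha). split; [apply Rmult_lt_0_compat; assumption|].
  intros r Hr. set (s := (1 + r) / 2). assert (Hs : r <= s < 1) by (unfold s; lra).
  specialize (H r s ltac:(lra) ltac:(lra) ltac:(lra)). cbv beta in H.
  assert (Hr2 := one_minus_sq_pos r Hr).
  assert (Hs2 := one_minus_sq_pos s ltac:(lra)).
  generalize (Rpower_pos (1 - r ^ 2) alpha) (Rpower_pos (1 - s ^ 2) alpha). intros P1 P2.
  assert (L : Rpower (1 - r ^ 2) alpha <= Rpower 2 alpha * Rpower (1 - s ^ 2) alpha).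
  { rewrite Rpower_mult_distr by lra. apply Rle_Rpower_l; [lra|].
    split; [exact Hr2|]. unfold s. nra. }
  apply Rmult_le_compat_r with (r := Rpower (1 - r ^ 2) alpha) in H; [|lra].
  replace (nu r / Rpower (1 - r ^ 2) alpha * Rpower (1 - r ^ 2) alpha) with (nu r)
    in H by (field; lra).
  apply Rle_trans with (1 := H).
  assert (Hns : 0 <= nu s / Rpower (1 - s ^ 2) alpha).
  { apply Rmult_le_pos; [apply W1; lra|]. left. apply Rinv_0_lt_compat, P2. }
  apply Rle_trans with (C0 * (nu s / Rpower (1 - s ^ 2) alpha) *
    (Rpower 2 alpha * Rpower (1 - s ^ 2) alpha)).
  - apply Rmult_le_compat_l; [apply Rmult_le_pos; lra|exact L].
  - right. field. lra.
Qed.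

(** Since 1 - s^2 <= 1 - r^2, raising the exponent from alpha to an integer n above it keeps the
    inequality; an integer exponent keeps the test functions rational. *)
Lemma property_U_pow (nu : R -> R) : weight nu -> property_U nu ->
  exists K n, 0 < K /\ forall r s, 0 <= r -> r <= s -> s < 1 ->
    nu r * (1 - s ^ 2) ^ n <= K * nu s * (1 - r ^ 2) ^ n.
Proof.
  intros [W1 _] [alpha [Ha [C0 [HC H]]]].
  destruct (INR_unbounded alpha) as [n Hn].
  exists C0, n. split; [exact HC|]. intros r s Hr Hrs Hs.
  specialize (H r s Hr Hrs Hs). cbv beta in H.
  assert (Hr2 := one_minus_sq_pos r ltac:(lra)).
  assert (Hs2 := one_minus_sq_pos s ltac:(lra)).
  rewrite <- (Rpower_pow n (1 - r ^ 2)), <- (Rpower_pow n (1 - s ^ 2)) by assumption.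
  replace (INR n) with (alpha + (INR n - alpha)) by ring. rewrite !Rpower_plus.
  set (b := INR n - alpha).
  generalize (Rpower_pos (1 - r ^ 2) alpha) (Rpower_pos (1 - s ^ 2) alpha)
   (Rpower_pos (1 - r ^ 2) b) (Rpower_pos (1 - s ^ 2) b). intros P1 P2 P3 P4.
  assert (L : Rpower (1 - s ^ 2) b <= Rpower (1 - r ^ 2) b).
  { apply Rle_Rpower_l; [unfold b; lra|]. nra. }
  apply Rmult_le_compat_r with
    (r := Rpower (1 - r ^ 2) alpha * Rpower (1 - s ^ 2) alpha) in H;
    [|apply Rmult_le_pos; lra].
  assert (H' : nu r * Rpower (1 - s ^ 2) alpha <= C0 * nu s * Rpower (1 - r ^ 2) alpha).
  { eapply Rle_trans; [|eapply Rle_trans; [exact H|]]; right; field; lra. }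
  rewrite <- !Rmult_assoc.
  assert (0 <= nu r) by (apply W1; lra). assert (0 <= nu s) by (apply W1; lra).
  apply Rmult_le_compat; try lra. apply Rmult_le_pos; lra.
Qed.

Lemma weighted_Cauchy_estimate (nu : R -> R) : weight nu -> property_U nu ->
  exists K, 0 < K /\ forall f z N, analytic f -> inD z ->
    (forall w, inD w -> Cmod (w - z) = (1 - Cmod z) / 2 -> nu (Cmod w) * Cmod (f w) <= N) ->
    (1 - Cmod z ^ 2) * nu (Cmod z) * Cmod (cderiv f z) <= K * N.
Proof.
  intros Wnu HU. destruct (property_U_midpoint nu Wnu HU) as [K [HK HUK]].
  destruct Wnu as [W1 [_ W3]].
  exists (4 * K). split; [lra|]. intros f z N Hf Hz HN.
  assert (Hz' := Cmod_inD z Hz).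
  set (rho := (1 - Cmod z) / 2) in *.
  set (s := (1 + Cmod z) / 2) in *.
  assert (Hrho : 0 < rho) by (unfold rho; lra).
  assert (Hs : 0 <= s < 1) by (unfold s; lra).
  assert (HD : forall w, Cmod (w - z) <= rho -> inD w).
  { intros w. apply inD_closed_disk. unfold rho. lra. }
  assert (Hsw : forall w, Cmod (w - z) = rho -> nu s * Cmod (f w) <= N).
  { intros w Hw. assert (Hw1 : inD w) by (apply HD; lra).
    apply Rle_trans with (2 := HN w Hw1 Hw).
    apply Rmult_le_compat_r; [apply Cmod_ge_0|]. apply W3; [apply Cmod_ge_0| |lra].
    replace w with ((w - z) + z)%C by ring.
    generalize (Cmod_triangle (w - z) z). rewrite Hw. unfold rho, s. lra. }
  assert (Hns : 0 <= nu s) by (apply W1; lra).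
  assert (HN0 : 0 <= N).
  (* Any point of the circle shows N >= 0; z + rho is one. *)
  { eapply Rle_trans; [|apply (Hsw (z + RtoC rho)%C)].
    - apply Rmult_le_pos; [exact Hns|apply Cmod_ge_0].
    - replace (z + rho - z)%C with (RtoC rho) by ring.
      rewrite Cmod_R, Rabs_right; lra. }
  assert (Hnz : 0 <= nu (Cmod z) <= K * nu s).
  { split; [apply W1; lra|]. apply HUK. lra. }
  (* 1 - |z|^2 <= 2 (1 - |z|) = 4 rho, the origin of the factor 4. *)
  assert (Hq : 0 < 1 - Cmod z ^ 2 <= 4 * rho) by (unfold rho; nra).
  generalize (Cmod_ge_0 (cderiv f z)). intros Hd.
  assert (HKns : (1 - Cmod z ^ 2) * nu (Cmod z) <= 4 * rho * (K * nu s)).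
  { apply Rmult_le_compat; lra. }
  apply Rle_trans with (4 * rho * (K * nu s) * Cmod (cderiv f z)).
  { apply Rmult_le_compat_r; assumption. }
  assert (HE : nu s * Cmod (cderiv f z) * rho <= N).
  (* If nu s = 0 the bound N / nu s on the circle is meaningless, but the left side is then 0. *)
  { destruct (Req_dec (nu s) 0) as [E|E].
    - rewrite E. lra.
    - assert (Hest : Cmod (cderiv f z) <= N / nu s / rho).
      { apply Cauchy_estimate; [exact Hrho|intros w Hw; apply Hf, HD, Hw|].
        intros w Hw. apply Rmult_le_reg_l with (nu s); [lra|].
        replace (nu s * (N / nu s)) with N by (field; exact E). apply Hsw, Hw. }
      apply Rmult_le_compat_l with (r := nu s * rho) in Hest; [|apply Rmult_le_pos; lra].
      replace (nu s * rho * (N / nu s / rho)) with N in Hest by (field; lra). lra. }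
  apply Rmult_le_compat_l with (r := 4 * K) in HE; [|lra]. lra.
Qed.


Lemma cond2_pointwise (g : C -> C) (nu mu : R -> R) :
  analytic g -> weight nu -> property_U nu -> cond2 g nu mu ->
  exists M, 0 < M /\ forall f z N, analytic f -> inD z ->
    (forall w, inD w -> Cmod (w - z) = (1 - Cmod z) / 2 -> nu (Cmod w) * Cmod (f w) <= N) ->
    mu (Cmod z) * Cmod (cderiv (Sg g f) z) <= M * N.
Proof.
  intros Hg Wnu HU [M HM].
  destruct (weighted_Cauchy_estimate nu Wnu HU) as [K [HK HE]].
  generalize (Rabs_pos M). intros HMp.
  (* The constant of [cond2] has no sign; a strictly positive one is wanted because the vanishing
     case divides by it. *)
  exists ((Rabs M + 1) * K). split; [apply Rmult_lt_0_compat; lra|].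
  intros f z N Hf Hz HN.
  rewrite cderiv_Sg, Cmod_mult by assumption.
  specialize (HE f z N Hf Hz HN). specialize (HM z Hz).
  assert (Hz' := Cmod_inD z Hz). assert (Hz2 := one_minus_sq_pos _ Hz').
  assert (Hnz : 0 <= (1 - Cmod z ^ 2) * nu (Cmod z)).
  { apply Rmult_le_pos; [lra|]. apply Wnu, Hz'. }
  assert (HM' : mu (Cmod z) * Cmod (g z) <= (Rabs M + 1) * ((1 - Cmod z ^ 2) * nu (Cmod z))).
  { apply Rle_trans with (1 := HM). apply Rmult_le_compat_r; [exact Hnz|].
    generalize (Rle_abs M). lra. }
  apply Rmult_le_compat_r with (r := Cmod (cderiv f z)) in HM'; [|apply Cmod_ge_0].
  apply Rmult_le_compat_l with (r := Rabs M + 1) in HE; [|lra].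
  lra.
Qed.

Lemma Bnorm_le_Sg (g f : C -> C) (mu : R -> R) (K : R) :
  (forall z, inD z -> mu (Cmod z) * Cmod (cderiv (Sg g f) z) <= K) ->
  Bnorm_le mu (Sg g f) K.
Proof. intros H z Hz. rewrite Sg_0, Cmod_0, Rplus_0_l. apply H, Hz. Qed.

Lemma cond2_Sg_bounded_inf (g : C -> C) (nu mu : R -> R) :
  analytic g -> weight nu -> property_U nu -> cond2 g nu mu ->
  Sg_bounded_inf g nu mu.
Proof.
  intros Hg Wnu HU H2.
  destruct (cond2_pointwise g nu mu Hg Wnu HU H2) as [M [HM HE]].
  exists M. split; [lra|]. intros f [Hf [K HK]].
  assert (B : forall K, Hnorm_le nu f K -> Bnorm_le mu (Sg g f) (M * K)).
  { intros N HN. apply Bnorm_le_Sg. intros z Hz. apply HE; try assumption.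
    intros w Hw _. apply HN, Hw. }
  split; [|exact B]. split; [apply analytic_Sg; assumption|].
  exists (M * K). apply B, HK.
Qed.

Lemma cond2_Sg_little_o (g f : C -> C) (nu mu : R -> R) :
  analytic g -> weight nu -> property_U nu -> cond2 g nu mu ->
  in_H0 nu f -> in_B0 mu (Sg g f).
Proof.
  intros Hg Wnu HU H2 [Hf H0].
  destruct (cond2_pointwise g nu mu Hg Wnu HU H2) as [M [HM HE]].
  split; [apply analytic_Sg; assumption|]. intros e He.
  destruct (H0 (e / (2 * M))) as [r0 [Hr0 Hr]]; [apply Rdiv_lt_0_compat; lra|].
  (* Points of the circle satisfy |w| >= (3|z| - 1)/2, which exceeds r0 exactly when |z| > (1 + 2
     r0)/3. *)
  exists ((1 + 2 * r0) / 3). split; [lra|]. intros z Hz Hrz.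
  apply Rle_lt_trans with (M * (e / (2 * M))).
  - apply HE; try assumption. intros w Hw Hwz. left. apply Hr; [exact Hw|].
    generalize (Cmod_triangle_inv z (z - w)).
    replace (z - (z - w))%C with w by ring.
    replace (z - w)%C with (- (w - z))%C by ring. rewrite Cmod_opp, Hwz. lra.
  - replace (M * (e / (2 * M))) with (e / 2) by (field; lra). lra.
Qed.

Lemma cond2_Sg_bounded_0 (g : C -> C) (nu mu : R -> R) :
  analytic g -> weight nu -> property_U nu -> cond2 g nu mu ->
  Sg_bounded_0 g nu mu.
Proof.
  intros Hg Wnu HU H2.
  destruct (cond2_pointwise g nu mu Hg Wnu HU H2) as [M [HM HE]].
  exists M. split; [lra|]. intros f Hf. split.
  - apply (cond2_Sg_little_o g f nu mu); assumption.
  - intros K HK. apply Bnorm_le_Sg. intros z Hz. apply HE; [apply Hf|exact Hz|].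
    intros w Hw _. apply HK, Hw.
Qed.

(** * Test functions and the necessity of the weight condition *)

(** The zero at a makes the derivative at a equal to the value of the other factor, uniformly in a.
    A bare power of 1 / (1 - conj(a) z) would bring a factor conj(a), which degenerates at a = 0.
    The exponent n + 1 leaves n after Schwarz-Pick absorbs one denominator. *)
Definition test_fun (a : C) (n : nat) (z : C) : C :=
  ((z - a) * (/ (1 - Cconj a * z)) ^ S n)%C.

Lemma Cmod_conj_mult_sub (a z : C) : inD z -> inD a ->
  1 - Cmod a <= Cmod (1 - Cconj a * z) /\ 1 - Cmod z <= Cmod (1 - Cconj a * z).
Proof.
  unfold inD. intros Hz Ha. generalize (Cmod_triangle_inv 1 (Cconj a * z)).
  rewrite Cmod_1, Cmod_mult, Cmod_conj.
  generalize (Cmod_ge_0 a) (Cmod_ge_0 z). intros. split; nra.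
Qed.

Lemma Schwarz_Pick_factor (a z : C) : inD z -> inD a ->
  Cmod (z - a) <= Cmod (1 - Cconj a * z).
Proof.
  unfold inD. intros Hz Ha. generalize (Cmod_ge_0 z) (Cmod_ge_0 a). intros Hz0 Ha0.
  apply Rsqr_incr_0; try apply Cmod_ge_0. rewrite !Rsqr_pow2.
  assert (E : Cmod (1 - Cconj a * z) ^ 2 - Cmod (z - a) ^ 2
    = (1 - Cmod a ^ 2) * (1 - Cmod z ^ 2)).
  { rewrite !Cmod2_alt. destruct a as [a1 a2], z as [z1 z2]. simpl. ring. }
  assert (0 <= (1 - Cmod a ^ 2) * (1 - Cmod z ^ 2)) by (apply Rmult_le_pos; nra).
  lra.
Qed.

Lemma Cder_Cpow (f : C -> C) (z : C) (n : nat) : ex_Cder f z ->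
  ex_Cder (fun w => f w ^ n)%C z.
Proof.
  intros [l Hl]. induction n as [|n [m Hm]].
  - exists (RtoC 0). exact (Cder_const 1 z).
  - eexists. exact (Cder_mult f (fun w => f w ^ n)%C z l m Hl Hm).
Qed.

Lemma ex_Cder_test_factor (a z : C) (n : nat) : inD z -> inD a ->
  ex_Cder (fun w => (/ (1 - Cconj a * w)) ^ n)%C z.
Proof.
  intros Hz Ha. apply Cder_Cpow.
  assert (N : (1 - Cconj a * z)%C <> 0%C).
  { apply Cmod_gt_0. generalize (proj1 (Cmod_conj_mult_sub a z Hz Ha)).
    unfold inD in Ha. lra. }
  eexists. apply (Cder_inv_comp (fun w => 1 - Cconj a * w)%C); [exact N|].
  apply Cder_minus; [apply Cder_const|].
  apply (Cder_mult (fun _ => Cconj a)); [apply Cder_const|apply Cder_id].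
Qed.

(** In the product rule the derivative m of the power is multiplied by a - a, so it is never
    computed. *)
Lemma test_fun_derive (a : C) (n : nat) : inD a ->
  Cmod (cderiv (test_fun a n) a) = / (1 - Cmod a ^ 2) ^ S n.
Proof.
  intros Ha. destruct (ex_Cder_test_factor a a (S n) Ha Ha) as [m Hm].
  assert (Hid : Cder (fun w => w - a)%C a (RtoC 1 - 0)%C).
  { apply Cder_minus; [apply Cder_id|apply Cder_const]. }
  assert (H := Cder_mult (fun w => w - a)%C (fun w => (/ (1 - Cconj a * w)) ^ S n)%C a
    _ m Hid Hm).
  rewrite (cderiv_unique (test_fun a n) a _ H).
  replace ((1 - 0) * (/ (1 - Cconj a * a)) ^ S n + (a - a) * m)%C with
    ((/ (1 - Cconj a * a)) ^ S n)%C by ring.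
  assert (E : (1 - Cconj a * a)%C = RtoC (1 - Cmod a ^ 2)).
  { rewrite RtoC_minus, Cmult_comm, Cmod2_conj. reflexivity. }
  assert (P := one_minus_sq_pos _ (Cmod_inD a Ha)).
  rewrite E, Cmod_pow, Cmod_inv, Cmod_R, Rabs_right by
    (try lra; intros K; apply RtoC_inj in K; lra).
  apply pow_inv.
Qed.

Lemma analytic_test_fun (a : C) (n : nat) : inD a -> analytic (test_fun a n).
Proof.
  intros Ha z Hz. destruct (ex_Cder_test_factor a z (S n) Hz Ha) as [m Hm].
  eexists. apply (Cder_mult (fun w => w - a)%C); [|exact Hm].
  apply Cder_minus; [apply Cder_id|apply Cder_const].
Qed.

Lemma Cmod_test_fun_le (a z : C) (n : nat) : inD a -> inD z ->
  Cmod (test_fun a n z) <= / Cmod (1 - Cconj a * z) ^ n.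
Proof.
  intros Ha Hz. unfold test_fun.
  assert (P : 0 < Cmod (1 - Cconj a * z)).
  { generalize (proj1 (Cmod_conj_mult_sub a z Hz Ha)). unfold inD in Ha. lra. }
  rewrite Cmod_mult, Cmod_pow, Cmod_inv by (apply Cmod_gt_0, P).
  rewrite <- pow_inv, <- tech_pow_Rmult, <- Rmult_assoc.
  rewrite <- (Rmult_1_l ((/ Cmod (1 - Cconj a * z)) ^ n)) at 2.
  apply Rmult_le_compat_r; [apply pow_le; left; apply Rinv_0_lt_compat, P|].
  apply Rmult_le_reg_r with (1 := P). rewrite Rmult_assoc, Rinv_l by lra.
  rewrite Rmult_1_r, Rmult_1_l. apply Schwarz_Pick_factor; assumption.
Qed.

(** With q = |1 - conj(a) z|, both 1 - |a|^2 and 1 - |z|^2 are at most 2 q, whence 2^n. If |z| >=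
    |a|, monotonicity of nu suffices; if |z| < |a|, property (U) moves from z to a at the cost of K.
    The factor K + 1 covers both cases. *)
Lemma test_fun_norm (nu : R -> R) : weight nu -> property_U nu ->
  exists K n, forall a, inD a ->
    Hnorm_le nu (test_fun a n) (K * nu (Cmod a) / (1 - Cmod a ^ 2) ^ n).
Proof.
  intros Wnu HU. destruct (property_U_pow nu Wnu HU) as [K [n [HK HP]]].
  destruct Wnu as [W1 [_ W3]].
  exists (2 ^ n * (K + 1)), n. intros a Ha z Hz.
  assert (Ha' := Cmod_inD a Ha). assert (Hz' := Cmod_inD z Hz).
  assert (Pa := one_minus_sq_pos _ Ha'). assert (Pz := one_minus_sq_pos _ Hz').
  destruct (Cmod_conj_mult_sub a z Hz Ha) as [D1 D2].
  set (q := Cmod (1 - Cconj a * z)) in *.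
  assert (Hq : 0 < q) by lra.
  assert (Hqn : 0 < q ^ n) by (apply pow_lt, Hq).
  assert (H2n : 0 < 2 ^ n) by (apply pow_lt; lra).
  assert (Han : 0 < (1 - Cmod a ^ 2) ^ n) by (apply pow_lt, Pa).
  assert (Hna : 0 <= nu (Cmod a)) by apply W1, Ha'.
  assert (Hnz : 0 <= nu (Cmod z)) by apply W1, Hz'.
  assert (Key : nu (Cmod z) * (1 - Cmod a ^ 2) ^ n <= 2 ^ n * (K + 1) * nu (Cmod a) * q ^ n).
  { replace (2 ^ n * (K + 1) * nu (Cmod a) * q ^ n) with
      ((K + 1) * nu (Cmod a) * (2 * q) ^ n) by (rewrite Rpow_mult_distr; ring).
    destruct (Rle_lt_dec (Cmod a) (Cmod z)) as [H|H].
    - apply Rmult_le_compat; [lra|lra| |].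
      + apply Rle_trans with (1 * nu (Cmod a)); [|apply Rmult_le_compat_r; lra].
        rewrite Rmult_1_l. apply W3; lra.
      + apply pow_incr. split; [lra|]. nra.
    - apply Rle_trans with (1 := HP (Cmod z) (Cmod a) ltac:(lra) ltac:(lra) ltac:(lra)).
      apply Rmult_le_compat.
      + apply Rmult_le_pos; lra.
      + apply pow_le; lra.
      + apply Rmult_le_compat_r; lra.
      + apply pow_incr. split; [lra|]. nra. }
  apply Rle_trans with (nu (Cmod z) * / q ^ n).
  { apply Rmult_le_compat_l; [exact Hnz|]. apply Cmod_test_fun_le; assumption. }
  apply Rmult_le_reg_r with (q ^ n * (1 - Cmod a ^ 2) ^ n);
    [apply Rmult_lt_0_compat; assumption|].
  eapply Rle_trans; [|eapply Rle_trans; [exact Key|]]; right; field; lra.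
Qed.

(** For fixed a the function is bounded by (1 - |a|)^-n, so the decay of nu alone gives the
    limit. *)
Lemma test_fun_in_H0 (nu : R -> R) (a : C) (n : nat) : weight nu -> typical nu ->
  inD a -> in_H0 nu (test_fun a n).
Proof.
  intros [W1 _] Ht Ha. split; [apply analytic_test_fun, Ha|]. intros e He.
  assert (Ha' := Cmod_inD a Ha).
  assert (P : 0 < (1 - Cmod a) ^ n) by (apply pow_lt; lra).
  destruct (Ht (e * (1 - Cmod a) ^ n)) as [r0 [Hr0 Hr]]; [apply Rmult_lt_0_compat; assumption|].
  exists r0. split; [exact Hr0|]. intros z Hz Hrz.
  assert (Hz' := Cmod_inD z Hz).
  specialize (Hr (Cmod z) ltac:(lra) ltac:(lra)).
  assert (Hnz : 0 <= nu (Cmod z)) by (apply W1; lra).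
  rewrite Rabs_right in Hr by lra.
  apply Rle_lt_trans with (nu (Cmod z) * / (1 - Cmod a) ^ n).
  - apply Rmult_le_compat_l; [exact Hnz|].
    apply Rle_trans with (1 := Cmod_test_fun_le a z n Ha Hz).
    apply Rinv_le_contravar; [exact P|]. apply pow_incr.
    generalize (proj1 (Cmod_conj_mult_sub a z Hz Ha)). lra.
  - apply Rmult_lt_reg_r with (1 := P). rewrite Rmult_assoc, Rinv_l by lra. lra.
Qed.

(** The hypothesis is what boundedness on either the large or the small space says about test
    functions, so both converses follow from it. The norm inequality is read at the point a
    itself. *)
Lemma test_fun_cond2 (g : C -> C) (nu mu : R -> R) (M : R) :
  analytic g -> weight nu -> property_U nu ->
  (forall a n K, inD a -> Hnorm_le nu (test_fun a n) K ->
     Bnorm_le mu (Sg g (test_fun a n)) (M * K)) ->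
  cond2 g nu mu.
Proof.
  intros Hg Wnu HU HB. destruct (test_fun_norm nu Wnu HU) as [K [n HK]].
  exists (M * K). intros a Ha.
  generalize (HB a n _ Ha (HK a Ha) a Ha).
  rewrite Sg_0, Cmod_0, Rplus_0_l, cderiv_Sg, Cmod_mult, test_fun_derive;
    try assumption; try (apply analytic_test_fun, Ha).
  assert (P := one_minus_sq_pos _ (Cmod_inD a Ha)). set (x := 1 - Cmod a ^ 2) in *.
  assert (Pn : 0 < x ^ n) by (apply pow_lt, P).
  (* Multiplying by x^(n+1) cancels the derivative at a and leaves one factor x = 1 - |a|^2 against
     the norm bound. *)
  intros H. apply Rmult_le_compat_r with (r := x * x ^ n) in H;
    [|apply Rmult_le_pos; lra].
  eapply Rle_trans; [|eapply Rle_trans; [exact H|]]; right; simpl; field; lra.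
Qed.

Theorem theorem5 (g : C -> C) (nu mu : R -> R) :
  analytic g -> weight nu -> property_U nu -> weight mu ->
  (Sg_bounded_inf g nu mu <-> cond2 g nu mu) /\
  (typical nu -> typical mu ->
     (Sg_bounded_0 g nu mu <-> Sg_bounded_inf g nu mu) /\
     (Sg_bounded_0 g nu mu <-> cond2 g nu mu)).
Proof.
  intros Hg Wnu HU _.
  assert (E12 : Sg_bounded_inf g nu mu <-> cond2 g nu mu).
  { split.
    - intros [M [_ HB]]. apply (test_fun_cond2 g nu mu M); try assumption.
      intros a n K Ha HK. apply HB; [|exact HK].
      split; [apply analytic_test_fun, Ha|exists K; exact HK].
    - apply cond2_Sg_bounded_inf; assumption. }
  split; [exact E12|]. intros Tnu _.
  assert (E32 : Sg_bounded_0 g nu mu <-> cond2 g nu mu).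
  { split.
    - intros [M [_ HB]]. apply (test_fun_cond2 g nu mu M); try assumption.
      intros a n K Ha HK. apply HB; [|exact HK].
      apply test_fun_in_H0; assumption.
    - apply cond2_Sg_bounded_0; assumption. }
  split; [|exact E32]. rewrite E12. exact E32.
Qed.
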